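(* Let $(W,S)$ be an arbitrary Coxeter system (possibly of infinite rank). (1) Suppose that $s\in S$, and that $W^{\perp s}{}_{\mathrm{fin}}$ is either trivial or generated by a single reflection conjugate to $s$ in $W$. Then $f(s)\in {S'}^{W'}$ for any Coxeter system $(W',S')$ and any group isomorphism $f:W\to W'$. (2) Suppose that every $s\in S$ satisfies the hypothesis of (1), i.e. for every $s\in S$ the group $W^{\perp s}{}_{\mathrm{fin}}$ is either trivial or generated by a single reflection conjugate to $s$ in $W$. Then $f(S)\subseteq{S'}^{W'}$ for any Coxeter system $(W',S')$ and any group isomorphism $f:W\to W'$, so $f$ preserves the set of reflections (that is, $f(S^W)={S'}^{W'}$). Hence the set $S^W$ is determined by $W$ only and is independent of the choice of $S\subseteq W$ (among the subsets making $W$ a Coxeter group).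
   Context: A Coxeter system $(W,S)$: $W$ is a group with presentation $\langle S\mid (st)^{m_{s,t}}=1 \text{ for } s,t\in S \text{ with } m_{s,t}<\infty\rangle$, where $m_{s,t}=m_{t,s}\in\{1,2,\dots\}\cup\{\infty\}$ and $m_{s,t}=1$ iff $s=t$. $S$ may be infinite. $S^W=\bigcup_{w\in W}wSw^{-1}$ is the set of reflections of $(W,S)$; similarly ${S'}^{W'}$ for $(W',S')$. For $s\in S$, $W^{\perp s}$ denotes the subgroup of $W$ generated by all reflections $t\in S^W$ with $t\ne s$ and $ts=st$. By a theorem of Deodhar and of Dyer, every subgroup $R$ of $W$ generated by reflections is a Coxeter group with respect to the canonical generating set $\{t\in S^W\cap R \mid \text{ no } r\in S^W\cap R,\ r\neq t, \text{ satisfies } \ell(tr)<\ell(t)\}$, where $\ell$ is the length function of $(W,S)$. For a Coxeter group $R$ with its generating set, the irreducible components are the subgroups generated by the connected components of the Coxeter graph (the graph on the generating set with $s,t$ joined iff the order $m_{s,t}$ of $st$ is at least $3$), and $R_{\mathrm{fin}}$ denotes the subgroup of $R$ generated by (the restricted direct product of) all finite irreducible components of $R$. Thus $W^{\perp s}{}_{\mathrm{fin}}$ is the product of the finite irreducible components of the Coxeter group $W^{\perp s}$. *)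

(* Defs.v *)
From Stdlib Require Import Relation_Operators.
From HB Require Import structures.
From mathcomp Require Import all_boot.
From mathcomp Require Import boolp classical_sets cardinality.

Set Implicit Arguments.
Unset Strict Implicit.
Unset Printing Implicit Defensive.

Local Open Scope classical_set_scope.
Local Open Scope group_scope.

Section GroupPresentations.
Variables (G : groupType) (I : Type) (gen : I -> G).

(* The letter (i, b) stands for the generator i if b = false and for its
   formal inverse if b = true. *)
Definition word : Type := seq (I * bool).

Definition word_eval (w : word) : G :=
  \prod_(l <- w) (if l.2 then (gen l.1)^-1 else gen l.1).

Inductive word_step (rels : set word) : word -> word -> Prop :=
| WordCancel (u v : word) i b :
    word_step rels (u ++ [:: (i, b); (i, ~~ b)] ++ v) (u ++ v)
| WordRelator (u v r : word) :
    rels r -> word_step rels (u ++ r ++ v) (u ++ v).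

(* Equality in the abstract group <I | rels>. *)
Definition word_equiv (rels : set word) : word -> word -> Prop :=
  clos_refl_sym_trans word (word_step rels).

(* The map <I | rels> -> G induced by gen is a well-defined bijection. *)
Definition is_presentation (rels : set word) : Prop :=
  (forall g, exists w, word_eval w = g) /\
  (forall u v, word_eval u = word_eval v <-> word_equiv rels u v).

End GroupPresentations.

Section CoxeterMatrix.
Variables (I : Type) (m : I -> I -> option nat).

(* None encodes the value infinity. *)
Definition coxeter_matrix : Prop :=
  [/\ forall s t, m s t = m t s,
      forall s t, m s t <> Some 0 &
      forall s t, m s t = Some 1%N <-> s = t].

Definition coxeter_relators : set (word I) :=
  [set r | exists s t n, m s t = Some n /\
             r = flatten (nseq n [:: (s, false); (t, false)])].

End CoxeterMatrix.

Section Subgroups.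
Variable G : groupType.

Definition generated (A : set G) : set G :=
  smallest (fun H : set G => group_closed [in H]) A.

(* No n with 0 < n < k kills g; this includes g of infinite order. *)
Definition order_at_least (k : nat) (g : G) : Prop :=
  forall n, (0 < n < k)%N -> g ^+ n <> 1.

End Subgroups.

(* Coxeter graph and finite part of the subgroup generated by T, relative to
   the generating set T. *)
Section FinitePart.
Variables (G : groupType) (T : set G).

Definition coxeter_edge (s t : G) : Prop :=
  [/\ T s, T t & order_at_least 3 (s * t)].

Definition graph_component (t : G) : set G :=
  [set u | T u /\ clos_refl_trans G coxeter_edge t u].

Definition irreducible_components : set (set G) :=
  [set generated (graph_component t) | t in T].

Definition finite_part : set G :=
  generated (\bigcup_(C in irreducible_components `&` finite_set) C).

End FinitePart.

Section CoxeterSystems.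
Variables (W : groupType) (S : set W).

Definition coxeter_system : Prop :=
  exists m : S -> S -> option nat,
    coxeter_matrix m /\ is_presentation (fun s : S => val s) (coxeter_relators m).

Definition reflections : set W :=
  [set t | exists w s, S s /\ t = w * s * w^-1].

Definition is_product_of (w : W) (n : nat) : Prop :=
  exists l : n.-tuple S, w = \prod_(s <- l) val s.

(* In a Coxeter system S is closed under inversion and generates W, so the
   default value 0 is never used. *)
Definition cox_length (w : W) : nat :=
  match pselect (exists n, `[< is_product_of w n >]) with
  | left ex => ex_minn ex
  | right _ => 0%N
  end.

Definition canonical_generators (R : set W) : set W :=
  [set t | (reflections `&` R) t /\
     ~ exists r, [/\ (reflections `&` R) r, r <> t &
                     (cox_length (t * r) < cox_length t)%N]].

Definition reflection_perp (s : W) : set W :=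
  generated [set t | [/\ reflections t, t <> s & commute t s]].

Definition reflection_perp_fin (s : W) : set W :=
  finite_part (canonical_generators (reflection_perp s)).

Definition conjugate_in (s t : W) : Prop := exists w, t = w * s * w^-1.

Definition perp_fin_trivial_or_conj (s : W) : Prop :=
  reflection_perp_fin s = [set 1] \/
  exists t, [/\ reflections t, conjugate_in s t &
                reflection_perp_fin s = generated [set t]].

End CoxeterSystems.

(* Main.v *)
Require Import Defs.
From HB Require Import structures.
From mathcomp Require Import all_boot.
From mathcomp Require Import boolp classical_sets cardinality.
From Stdlib Require Import Reals Lra Relation_Operators.

(* For an involution w of a Coxeter group let E(w) be the set of reflections whose
   root is mapped to its opposite by w.  It is finite, it is normalised by the
   centraliser of w, and by induction on the length of w it generates a subgroup
   containing w.  Put X = f^-1(E(f s)), a finite set of involutions stable under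
   the centraliser of s.  For x in X one of y = x, y = x s fixes the root of s;
   the reflections in E(y) then have roots orthogonal to that of s, so they lie
   in R = W^{perp s}, and their R-conjugacy classes are finite.  A reflection
   with a finite class lies in a finite component of R: an element of its
   component fixing all roots of the class fixes all canonical simple roots,
   hence is 1.  Thus x or x s lies in R_fin for every x in X.  If f s is not a
   reflection, the hypothesis on R_fin leaves at most one possible element of X,
   and then f s, which is in the subgroup generated by E(f s), would be 1 or
   that element of E(f s).  The equality of the sets of reflections follows
   because a conjugation-stable generating set of reflections contains all
   reflections. *)

Set Implicit Arguments.
Unset Strict Implicit.
Unset Printing Implicit Defensive.

Delimit Scope nat_scope with N.
Local Open Scope classical_set_scope.
Local Open Scope group_scope.

(** * Chebyshev values *)

Section Chebyshev.
Variable p : R.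

(* cheb k is U_{k-1}(p/2), with U the Chebyshev polynomials of the second kind. *)
Fixpoint cheb (k : nat) : R :=
  match k with
  | 0 => 0%R
  | k'.+1 => match k' with 0 => 1%R | k''.+1 => (p * cheb k' - cheb k'')%R end
  end.

Lemma chebSS k : cheb k.+2 = (p * cheb k.+1 - cheb k)%R.
Proof. by []. Qed.

(** At $p = 2\cos x$ the recurrence is the addition formula for the sine. The factor [sin x] avoids
    a division. *)
Lemma cheb_sin (x : R) k :
  p = (2 * cos x)%R -> (cheb k * sin x)%R = sin (INR k * x).
Proof.
move=> px; elim/ltn_ind: k => -[_|[_|k IH]].
- by rewrite /= !Rmult_0_l sin_0.
- by rewrite /= !Rmult_1_l.
rewrite chebSS Rmult_minus_distr_r Rmult_assoc !IH // px !S_INR.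
have -> : ((INR k + 1 + 1) * x = (INR k + 1) * x + x)%R by ring.
have -> : (INR k * x = (INR k + 1) * x - x)%R by ring.
by rewrite sin_plus sin_minus; ring.
Qed.

End Chebyshev.

Lemma cheb2 k : cheb 2 k = INR k.
Proof.
elim/ltn_ind: k => -[//|[//|k IH]].
by rewrite chebSS !IH // !S_INR; ring.
Qed.

Lemma cheb_cos_ge0 n k : (1 < n)%N -> (k <= n)%N ->
  (0 <= cheb (2 * cos (PI / INR n)) k)%R.
Proof.
move=> n1 kn.
have n0 : (1 < INR n)%R by rewrite -[1%R]/(INR 1); apply/lt_INR/ltP.
have kn' : (0 <= INR k <= INR n)%R by split; [apply: pos_INR | apply/le_INR/leP].
have pi0 := PI_RGT_0.
have nV : (INR n * / INR n)%R = 1%R by apply: Rinv_r; lra.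
have nV0 : (0 < / INR n)%R by apply: Rinv_0_lt_compat; lra.
have s0 : (0 < sin (PI / INR n))%R.
  by apply: sin_gt_0; rewrite /Rdiv; nra.
have := @cheb_sin _ (PI / INR n)%R k erefl.
have : (0 <= sin (INR k * (PI / INR n)))%R.
  have ->: (INR k * (PI / INR n) = PI * (INR k * / INR n))%R by rewrite /Rdiv; ring.
  have : (0 <= INR k * / INR n <= 1)%R by nra.
  by move=> ?; apply: sin_ge_0; nra.
by move=> h1 h2; nra.
Qed.

(** The angle of [2 * n] steps is $2\pi$, so the last two values repeat those at 0 and 1; the
    recurrence run backwards gives the first. *)
Lemma cheb_cos_period n : (1 < n)%N ->
  [/\ cheb (2 * cos (PI / INR n)) (2 * n).-1 = (-1)%R,
      cheb (2 * cos (PI / INR n)) (2 * n) = 0%R &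
      cheb (2 * cos (PI / INR n)) (2 * n).+1 = 1%R].
Proof.
move=> n1.
have n0 : (1 < INR n)%R by rewrite -[1%R]/(INR 1); apply/lt_INR/ltP.
have pi0 := PI_RGT_0.
have nV : (INR n * / INR n)%R = 1%R by apply: Rinv_r; lra.
have nV0 : (0 < / INR n)%R by apply: Rinv_0_lt_compat; lra.
have s0 : (0 < sin (PI / INR n))%R.
  by apply: sin_gt_0; rewrite /Rdiv; nra.
have tn : (INR (2 * n) * (PI / INR n) = 0 + 2 * INR 1 * PI)%R.
  by rewrite -multE mult_INR /=; field; lra.
have h k := @cheb_sin _ (PI / INR n)%R k erefl.
have h0 := h (2 * n)%N; rewrite tn sin_period sin_0 in h0.
have h1 := h (2 * n)%N.+1; rewrite S_INR Rmult_plus_distr_r tn in h1.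
have e1 : (0 + 2 * INR 1 * PI + 1 * (PI / INR n) = PI / INR n + 2 * INR 1 * PI)%R by ring.
rewrite e1 sin_period in h1.
have z : cheb (2 * cos (PI / INR n)) (2 * n) = 0%R by nra.
have o : cheb (2 * cos (PI / INR n)) (2 * n).+1 = 1%R by nra.
split=> //.
case: (n) n1 z o => [//|n'] _.
rewrite mulnS /= => z o.
move: o; rewrite z.
by move: (cheb _ _) => ? ? ; lra.
Qed.

(** * Generated subgroups *)

Ltac gsimp :=
  rewrite ?(invgM, invgK, mulgA, mulgK, mulgVK, mulVg, mulgV, mul1g, mulg1, invg1).

Section Generated.
Variable G : groupType.
Implicit Types (A : set G) (g h : G).

Lemma sub_generated A : A `<=` generated A.
Proof. exact: sub_gen_smallest. Qed.

Lemma generated_closed A : group_closed [in generated A].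
Proof.
split=> [|x y]; rewrite !inE.
  by move=> H [[+ _] _]; rewrite inE.
move=> xA yA H [cH AH]; have [_] := cH.
move=> /(_ x y); rewrite !inE; apply; [exact: xA|exact: yA].
Qed.

Lemma generated1 A : generated A 1.
Proof. by have [] := generated_closed A; rewrite inE. Qed.

Lemma generatedM A g h : generated A g -> generated A h -> generated A (g * h).
Proof.
have /group_closedM/(_ g h) := generated_closed A; rewrite !inE.
by move=> + gA hA; apply.
Qed.

Lemma generatedV A g : generated A g -> generated A g^-1.
Proof. by have /group_closedV/(_ g) := generated_closed A; rewrite !inE. Qed.

Lemma generatedJ A g h : generated A g -> generated A h ->
  generated A (g * h * g^-1).
Proof. by move=> gA hA; do !apply: generatedM => //; apply: generatedV. Qed.

Lemma generated_ind A (P : G -> Prop) :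
  P 1 -> (forall g h, P g -> P h -> P (g * h)) -> (forall g, P g -> P g^-1) ->
  (forall g, A g -> P g) -> forall g, generated A g -> P g.
Proof.
move=> P1 PM PV PA; apply: (@smallest_sub _ _ _ [set g | P g]) => //.
by split=> [|x y]; rewrite !inE => // Px Py; apply: PM => //; apply: PV.
Qed.

Lemma generated_sub A (B : set G) : A `<=` generated B ->
  generated A `<=` generated B.
Proof.
move=> AB; apply: generated_ind; [exact: generated1 | exact: generatedM |
  exact: generatedV | exact: AB].
Qed.

Lemma generated_sub_conj A (B : set G) g :
  (forall x, A x -> generated B (g * x * g^-1)) ->
  forall x, generated A x -> generated B (g * x * g^-1).
Proof.
move=> AB; apply: generated_ind => //.
- by gsimp; apply: generated1.
- move=> x y xB yB; have -> : g * (x * y) * g^-1 = (g * x * g^-1) * (g * y * g^-1).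
    by gsimp.
  exact: generatedM.
- by move=> x xB; have := generatedV xB; gsimp.
Qed.

Lemma generated_centralize A g :
  (forall x, A x -> commute g x) -> forall x, generated A x -> commute g x.
Proof.
move=> gA; apply: generated_ind => //.
- exact: commute1.
- by move=> x y; apply: commuteM.
- by move=> x; apply: commuteV.
Qed.

Lemma generated_involutionsP A g : (forall x, A x -> x * x = 1) ->
  generated A g ->
  exists l : seq G, (forall x, x \in l -> A x) /\ g = \prod_(x <- l) x.
Proof.
move=> A2; move: g; apply: generated_ind.
- by exists [::]; rewrite big_nil.
- move=> _ _ [l [lA ->]] [l' [lA' ->]]; exists (l ++ l'); rewrite big_cat /=.
  by split=> // x; rewrite mem_cat => /orP[]; [apply: lA|apply: lA'].
- move=> _ [l [lA ->]]; exists (rev l); split=> [x|].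
    by rewrite mem_rev; apply: lA.
  elim: l lA => [|x l IH] lA; first by rewrite big_nil invg1.
  rewrite big_cons invgM rev_cons -cats1 big_cat big_seq1 IH => [|y yl].
    by congr (_ * _); apply: mulg1_eq; apply: A2; apply: lA; rewrite inE eqxx.
  by apply: lA; rewrite inE yl orbT.
- by move=> x xA; exists [:: x]; rewrite big_seq1; split=> // y; rewrite inE => /eqP ->.
Qed.

Lemma closed1 (H : set G) : group_closed [in H] -> H 1.
Proof. by case; rewrite inE. Qed.

Lemma closedM (H : set G) g h : group_closed [in H] -> H g -> H h -> H (g * h).
Proof.
by move=> /group_closedM/(_ g h) HM Hg Hh; move: HM; rewrite !inE; apply.
Qed.

Lemma closedV (H : set G) g : group_closed [in H] -> H g -> H g^-1.
Proof. by move=> /group_closedV/(_ g) + Hg; rewrite !inE; apply. Qed.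

End Generated.

(** Induction on [D]: one coordinate takes finitely many values and cuts [X] into finitely many
    fibres, each separated by the remaining coordinates. *)
Lemma finite_separated (A C : Type) (B : eqType) (X : set A) (D : set B)
    (Y : set C) (h : A -> B -> C) :
  finite_set D -> finite_set Y -> (forall a b, X a -> D b -> Y (h a b)) ->
  (forall a a', X a -> X a' -> (forall b, D b -> h a b = h a' b) -> a = a') ->
  finite_set X.
Proof.
move=> /finite_seqP[s ->] finY; elim: s X => [|b s IH] X XY Xinj.
  have [[a Xa]|nX] := pselect (exists a, X a).
    apply: (@sub_finite_set _ _ [set a]); last exact: finite_set1.
    by move=> a' Xa' /=; apply: Xinj.
  by apply: (@sub_finite_set _ _ set0) => // a Xa; case: nX; exists a.
apply: (@sub_finite_set _ _ (\bigcup_(y in Y) [set a | X a /\ h a b = y])).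
  move=> a Xa; exists (h a b) => //; apply: XY => //=.
  by rewrite inE eqxx.
apply: bigcup_finite => // y Yy; apply: IH.
  by move=> a b' [Xa _] /= b's; apply: XY => //=; rewrite inE b's orbT.
move=> a a' [Xa ab] [Xa' a'b] ha; apply: Xinj => // b' /=.
by rewrite inE => /orP[/eqP->|/ha //]; rewrite ab a'b.
Qed.

(** * Words and length *)

Section CoxeterWords.
Variables (W : groupType) (S : set W) (m : S -> S -> option nat).
Hypothesis cm : coxeter_matrix m.
Hypothesis pres : is_presentation (fun s : S => val s) (coxeter_relators m).
Implicit Types (s : S) (g w t : W) (l : seq S).

Local Notation ev := (word_eval (fun s : S => val s)).
Local Notation len := (cox_length S).

Lemma word_eval_cat (u v : word S) : ev (u ++ v) = ev u * ev v.
Proof. by rewrite /word_eval big_cat. Qed.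

Lemma word_eval_pairs (s t : S) n :
  ev (flatten (nseq n [:: (s, false); (t, false)])) = (val s * val t) ^+ n.
Proof.
elim: n => [|n IH]; first by rewrite /word_eval big_nil.
rewrite expgS -IH /= -cat1s -[X in _ ++ X]cat1s !word_eval_cat mulgA.
by rewrite /word_eval !big_seq1.
Qed.

Lemma mss s : m s s = Some 1%N.
Proof. by have [_ _ /(_ s s)[_ ->]] := cm. Qed.

Lemma coxeter_relation (s t : S) n : m s t = Some n -> (val s * val t) ^+ n = 1.
Proof.
move=> mst; rewrite -word_eval_pairs.
have -> : 1 = ev [::] by rewrite /word_eval big_nil.
apply/(pres.2); apply: rst_step.
rewrite -[X in word_step _ X _]cats0 -[X in word_step _ X _]cat0s.
by apply: WordRelator; exists s, t, n.
Qed.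

Lemma gen_sqr s : val s * val s = 1.
Proof. by have := coxeter_relation (mss s); rewrite expg1. Qed.

Lemma genV s : (val s)^-1 = val s.
Proof. exact/mulg1_eq/gen_sqr. Qed.

Lemma genKl s g : val s * (val s * g) = g.
Proof. by rewrite mulgA gen_sqr mul1g. Qed.

Lemma genKr s g : g * val s * val s = g.
Proof. by rewrite -mulgA gen_sqr mulg1. Qed.

Lemma word_eval_letters (u : word S) : ev u = \prod_(s <- map fst u) val s.
Proof.
rewrite /word_eval big_map; apply: eq_bigr => -[s []] _ //=.
exact: genV.
Qed.

Lemma letters_eval l : \prod_(s <- l) val s = ev [seq (s, false) | s <- l].
Proof. by rewrite word_eval_letters -map_comp map_id. Qed.

Lemma exists_letters w : exists l, w = \prod_(s <- l) val s.
Proof.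
by have [u <-] := pres.1 w; exists (map fst u); rewrite word_eval_letters.
Qed.

Lemma len_reduced w : exists l, size l = len w /\ w = \prod_(s <- l) val s.
Proof.
rewrite /cox_length; case: pselect => [ex|]; last first.
  case; have [l ->] := exists_letters w; exists (size l); apply/asboolP.
  by exists (in_tuple l).
case: ex_minnP => n /asboolP[l wl] _; exists l; split=> //.
by rewrite size_tuple.
Qed.

Lemma len_le l : (len (\prod_(s <- l) val s) <= size l)%N.
Proof.
have ex : `[< is_product_of S (\prod_(s <- l) val s) (size l) >].
  by apply/asboolP; exists (in_tuple l).
rewrite /cox_length; case: pselect => [e|]; last by case; exists (size l).
by case: ex_minnP => n _; apply.
Qed.

Lemma lenM g w : (len (g * w) <= len g + len w)%N.
Proof.
have [l [<- ->]] := len_reduced g; have [k [<- ->]] := len_reduced w.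
by rewrite -big_cat -size_cat; apply: len_le.
Qed.

Lemma lenV w : len w^-1 = len w.
Proof.
have lenV_le g : (len g^-1 <= len g)%N.
  have [l [<- ->]] := len_reduced g.
  suff -> : (\prod_(s <- l) val s)^-1 = \prod_(s <- rev l) val s.
    by rewrite -(size_rev l); apply: len_le.
  elim: l => [|s l IH]; first by rewrite big_nil invg1.
  by rewrite big_cons invgM rev_cons -cats1 big_cat big_seq1 IH genV.
by apply/eqP; rewrite eqn_leq lenV_le -{1}[w]invgK lenV_le.
Qed.

Lemma len1 : len 1 = 0%N.
Proof. by have := len_le [::]; rewrite big_nil leqn0 => /eqP. Qed.

Lemma len_gen s : (len (val s) <= 1)%N.
Proof. by have := len_le [:: s]; rewrite big_seq1. Qed.

(** * Letter counts modulo 2 *)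

Section Parity.
Variable Q : S -> bool.
Hypothesis Qm : forall (s t : S) n, m s t = Some n -> odd n -> Q s = Q t.

(** A cancelled pair counts the same letter twice, and a relator contributes [n * (Q s + Q t)],
    which is even by [Qm]. *)
Lemma parity_letters l k : \prod_(s <- l) val s = \prod_(s <- k) val s ->
  odd (count Q l) = odd (count Q k).
Proof.
rewrite !letters_eval => /(pres.2).
have cnt j : count Q j = count (fun x => Q x.1) [seq (s, false) | s <- j].
  by rewrite count_map.
rewrite !cnt; elim=> {l k cnt} [_ _ [u v s b|u v _ [s [t [n [mst ->]]]]]| | | ] //.
- by rewrite !count_cat /= addn0 addnn !oddD odd_double.
- rewrite !count_cat !oddD; congr (_ (+) _).
  set c := count _ _; suff -> : odd c = false by [].
  have -> : c = (n * (Q s + Q t))%N.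
    by rewrite /c {mst c}; elim: n => //= n ->; rewrite mulSn addnA.
  rewrite oddM oddD; case: (boolP (odd n)) => // on.
  by rewrite (Qm mst on) addbb.
- by move=> x y z _ -> _ ->.
Qed.

Definition parity w : bool :=
  odd (count Q (projT1 (cid (exists_letters w)))).

Lemma parity_prod l : parity (\prod_(s <- l) val s) = odd (count Q l).
Proof.
by apply: parity_letters; case: cid.
Qed.

Lemma parityM g w : parity (g * w) = parity g (+) parity w.
Proof.
have [l ->] := exists_letters g; have [k ->] := exists_letters w.
by rewrite -big_cat !parity_prod count_cat oddD.
Qed.

Lemma parity1 : parity 1 = false.
Proof. by have := parity_prod [::]; rewrite big_nil. Qed.

Lemma parityV w : parity w^-1 = parity w.
Proof.
by have := parityM w^-1 w; rewrite mulVg parity1; case: (parity w); case: parity.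
Qed.

Lemma parityJ g w : parity (g * w * g^-1) = parity w.
Proof. by rewrite !parityM parityV addbAC addbb. Qed.

Lemma parity_gen s : parity (val s) = Q s.
Proof. by have := parity_prod [:: s]; rewrite big_seq1 => -> /=; rewrite addn0 oddb. Qed.

End Parity.

Lemma odd_len w : odd (len w) = parity xpredT w.
Proof.
by have [l [<- e]] := len_reduced w; rewrite e parity_prod // count_predT.
Qed.

Lemma odd_lenM g w : odd (len (g * w)) = odd (len g) (+) odd (len w).
Proof. by rewrite !odd_len parityM. Qed.

Lemma reflection_gen s : reflections S (val s).
Proof. by exists 1, (val s); gsimp; split=> //; apply: set_valP. Qed.

Lemma reflectionP t :
  reflections S t <-> exists g s, t = g * val s * g^-1.
Proof.
split=> [[g [s [Ss ->]]]|[g [s ->]]].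
  by exists g, (SigSub (mem_set Ss)).
by exists g, (val s); split=> //; apply: set_valP.
Qed.

Lemma reflectionJ g t : reflections S t -> reflections S (g * t * g^-1).
Proof. by move=> [h [s [Ss ->]]]; exists (g * h), s; split=> //; gsimp. Qed.

Lemma reflection_sqr t : reflections S t -> t * t = 1.
Proof.
move=> /reflectionP[g [s ->]]; gsimp.
by rewrite -(mulgA g) gen_sqr; gsimp.
Qed.

Lemma reflectionV t : reflections S t -> t^-1 = t.
Proof. by move=> /reflection_sqr/mulg1_eq. Qed.

Lemma odd_len_reflection t : reflections S t -> odd (len t).
Proof.
by move=> /reflectionP[g [s ->]]; rewrite odd_len parityJ // parity_gen.
Qed.

Lemma len_refl_neq w t : reflections S t -> len (w * t) != len w.
Proof.
move=> /odd_len_reflection ot; apply/negP => /eqP/(congr1 odd).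
by rewrite odd_lenM ot; case: (odd _).
Qed.

Lemma reflection_neq1 t : reflections S t -> t <> 1.
Proof. by move=> /odd_len_reflection + t1; rewrite t1 len1. Qed.


(** * The contragredient geometric representation *)

(* Twice the Tits form, 2 B(a_s, a_t). *)
Definition coef (s t : S) : R :=
  match m s t with
  | Some n => (- (2 * cos (PI / INR n)))%R
  | None => (-2)%R
  end.

Lemma coef_sym (s t : S) : coef s t = coef t s.
Proof. by rewrite /coef; have [-> _ _] := cm. Qed.

Lemma coef_ss s : coef s s = 2%R.
Proof. by rewrite /coef (mss s) /= Rdiv_1_r cos_PI; ring. Qed.

Local Notation E := (S -> R).
Implicit Types (f h : E).

(** Here [f t] is the value of a linear form on the simple root of [t]; the form is composed with
    the reflection in the simple root of [s]. *)
Definition gen_act s f : E := fun t : S => (f t - f s * coef s t)%R.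

Definition seq_act l f : E := foldr gen_act f l.

Lemma gen_actK s f : gen_act s (gen_act s f) = f.
Proof. by apply/funext => t; rewrite /gen_act coef_ss; ring. Qed.

Lemma seq_act_cat l k f : seq_act (l ++ k) f = seq_act l (seq_act k f).
Proof. by rewrite /seq_act foldr_cat. Qed.

(** * Alternating words and the dihedral relations *)

Fixpoint alt (s t : S) (k : nat) : seq S :=
  if k is k'.+1 then s :: alt t s k' else [::].

Lemma size_alt (s t : S) k : size (alt s t k) = k.
Proof. by elim: k s t => //= k IH s t; rewrite IH. Qed.

Lemma alt_cat (s t : S) n k :
  alt s t (n + k) = alt s t n ++ (if odd n then alt t s k else alt s t k).
Proof. by elim: n s t => // n IH s t; rewrite addSn /= IH; case: (odd n). Qed.

Lemma rev_alt (s t : S) k :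
  rev (alt s t k) = if odd k then alt s t k else alt t s k.
Proof.
elim: k s t => // k IH s t.
have altS (x y : S) : alt x y k.+1 = rcons (alt x y k) (if odd k then y else x).
  by rewrite -addn1 alt_cat -cats1; case: odd.
have -> : rev (alt s t k.+1) = rcons (rev (alt t s k)) s by apply: rev_cons.
by rewrite IH !altS /=; case: (odd k).
Qed.

(** Each further letter produces a coordinate equal to [- coef s t] times the previous one minus the
    one before, which is the recurrence of [cheb]. *)
Lemma alt_act (s t : S) k f :
  seq_act (alt t s k) f s =
  if odd k then (cheb (- coef s t) k.+1 * f t + cheb (- coef s t) k * f s)%R
  else (cheb (- coef s t) k.+1 * f s + cheb (- coef s t) k * f t)%R.
Proof.
elim/ltn_ind: k s t => -[_|[_|k IH]] s t.
- by rewrite /=; ring.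
- by rewrite /= /gen_act (coef_sym t s); ring.
have -> : seq_act (alt t s k.+2) f s =
  (- seq_act (alt t s k) f s - coef s t * seq_act (alt s t k.+1) f t)%R.
  by rewrite /= {1}/gen_act {1}/gen_act coef_ss (coef_sym t s); ring.
rewrite !IH // (coef_sym t s) !(chebSS _ k.+1) !(chebSS _ k).
by rewrite /= negbK; case: (odd k) => /=; ring.
Qed.

Lemma alt_act_span (s t : S) k f : exists a b : R,
  forall x, seq_act (alt t s k) f x = (f x - a * coef s x - b * coef t x)%R.
Proof.
elim: k s t => [|k IH] s t; first by exists 0%R, 0%R => x /=; ring.
have [a [b H]] := IH t s; exists b, (a + seq_act (alt s t k) f t)%R => x.
by rewrite /= {1}/gen_act H; ring.
Qed.

Lemma m_gt1 (s t : S) n : s <> t -> m s t = Some n -> (1 < n)%N.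
Proof.
have [_ m0 m1] := cm; case: n => [|[|n]] // st mst; first by case: (m0 s t).
by case: st; apply/m1.
Qed.

(** The coordinates at [s] and [t] return by the Chebyshev period. The total change is a combination
    of [coef s] and [coef t], whose Gram matrix is invertible, so a change vanishing at [s] and [t]
    vanishes everywhere. *)
Lemma alt_act_relation (s t : S) n f : m s t = Some n ->
  seq_act (alt t s (2 * n)) f = f.
Proof.
move=> mst; have [st|st] := pselect (s = t).
  move: mst; rewrite st (mss t) => -[<-].
  exact: gen_actK.
have n1 := m_gt1 st mst.
have cst : coef s t = (- (2 * cos (PI / INR n)))%R by rewrite /coef mst.
have [c1 c2 c3] := cheb_cos_period n1.
have hs : seq_act (alt t s (2 * n)) f s = f s.
  by rewrite alt_act oddM [odd 2]/= andFb cst Ropp_involutive c2 c3; ring.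
(* The outermost letter is [t] itself; it is peeled off and the other $2n-1$ letters are
   evaluated. *)
have ht : seq_act (alt t s (2 * n)) f t = f t.
  have e : ((2 * n) = (2 * n).-1.+1)%N by rewrite prednK // muln_gt0 (ltnW n1).
  have o : odd (2 * n).-1 by have := oddM 2 n; rewrite {1}e /=; case: odd.
  rewrite e /= {1}/gen_act coef_ss alt_act o -e (coef_sym t s) cst.
  by rewrite Ropp_involutive c1 c2; ring.
have [a [b H]] := alt_act_span s t (2 * n) f.
move: hs ht; rewrite !H !coef_ss (coef_sym t s) cst => hs ht.
have s0 : (0 < sin (PI / INR n))%R.
  have n0 : (1 < INR n)%R by rewrite -[1%R]/(INR 1); apply/lt_INR/ltP.
  have pi0 := PI_RGT_0.
  have nV : (INR n * / INR n)%R = 1%R by apply: Rinv_r; lra.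
  have nV0 : (0 < / INR n)%R by apply: Rinv_0_lt_compat; lra.
  by apply: sin_gt_0; rewrite /Rdiv; nra.
have sc := sin2_cos2 (PI / INR n); rewrite /Rsqr in sc.
set c := cos _ in hs ht sc; set d := sin _ in s0 sc.
have ab : a = (c * b)%R by lra.
have ba : b = (c * a)%R by lra.
(* Combining [ab] and [ba] gives $(1-c^2)a=0$, where $1-c^2=\sin^2(\pi/n)>0$. *)
have dda : (d * d * a = 0)%R.
  have -> : (d * d = 1 - c * c)%R by lra.
  by rewrite Rmult_minus_distr_r Rmult_assoc -ba -ab; ring.
have dd0 : (0 < d * d)%R by apply: Rmult_lt_0_compat.
have a0 : a = 0%R by case: (Rmult_integral _ _ dda) => //; lra.
by apply/funext => x; rewrite H ba a0; ring.
Qed.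

Lemma relator_letters (s t : S) n :
  map fst (flatten (nseq n [:: (s, false); (t, false)])) = alt s t (2 * n).
Proof. by rewrite mul2n; elim: n => //= n ->. Qed.

Lemma seq_act_wd l k f : \prod_(s <- l) val s = \prod_(s <- k) val s ->
  seq_act l f = seq_act k f.
Proof.
rewrite !letters_eval => /(pres.2).
have unl j : j = map fst [seq (s, false) | s <- j] by rewrite -map_comp map_id.
rewrite {2}(unl l) {2}(unl k).
elim=> {l k unl} [_ _ [u v s b|u v _ [s [t [n [mst ->]]]]]|//|//|x y z _ -> _ -> //].
- by rewrite !map_cat !seq_act_cat /= gen_actK.
- rewrite !map_cat !seq_act_cat relator_letters alt_act_relation //.
  by have [-> _ _] := cm.
Qed.

(** * The action of the group, roots and coroots *)

Definition letters g : seq S := projT1 (cid (exists_letters g)).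

Lemma lettersK g : \prod_(s <- letters g) val s = g.
Proof. by rewrite /letters; case: cid. Qed.

Definition act g f : E := seq_act (letters g) f.

Lemma act_prod l f : act (\prod_(s <- l) val s) f = seq_act l f.
Proof. by apply: seq_act_wd; rewrite lettersK. Qed.

Lemma actM g w f : act (g * w) f = act g (act w f).
Proof. by rewrite /act -seq_act_cat; apply: seq_act_wd; rewrite big_cat /= !lettersK. Qed.

Lemma act1 f : act 1 f = f.
Proof. by have := act_prod [::] f; rewrite big_nil. Qed.

Lemma act_gen s f : act (val s) f = gen_act s f.
Proof. by have := act_prod [:: s] f; rewrite big_seq1. Qed.

Lemma actK g f : act g^-1 (act g f) = f.
Proof. by rewrite -actM mulVg act1. Qed.

Lemma actVK g f : act g (act g^-1 f) = f.
Proof. by rewrite -actM mulgV act1. Qed.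

Lemma seq_act_linear l (a b : R) f h x :
  seq_act l (fun y => a * f y + b * h y)%R x =
  (a * seq_act l f x + b * seq_act l h x)%R.
Proof. by elim: l x => //= s l IH x; rewrite /gen_act !IH; ring. Qed.

Lemma act_linear g (a b : R) f h x :
  act g (fun y => a * f y + b * h y)%R x = (a * act g f x + b * act g h x)%R.
Proof. exact: seq_act_linear. Qed.

(* The functional f |-> f s is the simple root of s, so that roots are functionals
   on S -> R; no finiteness of supports is needed even when S is infinite. *)
Definition root g s : E -> R := fun f => act g^-1 f s.

Definition coroot g s : E := act g (coef s).

Definition dual_act w (phi : E -> R) : E -> R := fun f => phi (act w^-1 f).

Lemma dual_act_root w g s : dual_act w (root g s) = root (w * g) s.
Proof. by apply/funext => f; rewrite /dual_act /root invgM actM. Qed.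

Lemma dual_actM w g phi : dual_act (w * g) phi = dual_act w (dual_act g phi).
Proof. by apply/funext => f; rewrite /dual_act invgM actM. Qed.

Lemma dual_act1 phi : dual_act 1 phi = phi.
Proof. by apply/funext => f; rewrite /dual_act invg1 act1. Qed.

Lemma root_linear g s (a b : R) f h :
  root g s (fun y => a * f y + b * h y)%R = (a * root g s f + b * root g s h)%R.
Proof. exact: act_linear. Qed.

Lemma root_coroot g s : root g s (coroot g s) = 2%R.
Proof. by rewrite /root /coroot actK coef_ss. Qed.

(** Simple reflections are self-adjoint for the symmetric form [coef], so a word moved to the other
    argument is reversed. *)
Lemma seq_act_coef_sym l (r s : S) :
  seq_act l (coef r) s = seq_act (rev l) (coef s) r.
Proof.
elim: l r s => [|q l IH] r s; first exact: coef_sym.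
rewrite rev_cons -cats1 seq_act_cat /=.
have -> : gen_act q (coef s) = (fun y => 1 * coef s y + (- coef s q) * coef q y)%R.
  by apply/funext => y; rewrite /gen_act; ring.
by rewrite seq_act_linear /gen_act !IH (coef_sym q s); ring.
Qed.

Lemma prod_rev l : (\prod_(s <- l) val s)^-1 = \prod_(s <- rev l) val s.
Proof.
elim: l => [|s l IH]; first by rewrite big_nil invg1.
by rewrite big_cons invgM rev_cons -cats1 big_cat big_seq1 IH genV.
Qed.

Lemma root_coroot_sym (g h : W) (s r : S) : root g s (coroot h r) = root h r (coroot g s).
Proof.
rewrite /root /coroot -!actM.
have -> : h^-1 * g = (g^-1 * h)^-1 by gsimp.
by rewrite -(lettersK (g^-1 * h)) prod_rev !act_prod seq_act_coef_sym.
Qed.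

Lemma act_reflection g s f x :
  act (g * val s * g^-1) f x = (f x - root g s f * coroot g s x)%R.
Proof.
rewrite !actM act_gen.
have -> : gen_act s (act g^-1 f) =
   (fun y => 1 * act g^-1 f y + (- root g s f) * coef s y)%R.
  by apply/funext => y; rewrite /gen_act /root; ring.
by rewrite act_linear actVK /coroot; ring.
Qed.

(** * Descents, reduced words and signs of roots *)

Lemma len_gen_cases s v :
  len (val s * v) = (len v).+1 \/ len v = (len (val s * v)).+1.
Proof.
have a1 : (len (val s * v) <= (len v).+1)%N.
  by apply: leq_trans (lenM _ _) _; rewrite -add1n leq_add2r len_gen.
have a2 : (len v <= (len (val s * v)).+1)%N.
  rewrite -{1}(genKl s v); apply: leq_trans (lenM _ _) _.
  by rewrite -add1n leq_add2r len_gen.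
have : len (val s * v) != len v.
  rewrite -(lenV (val s * v)) -(lenV v) invgM genV.
  exact/len_refl_neq/reflection_gen.
by case: (ltngtP (len (val s * v)) (len v)) => // h _; [right|left];
  apply/eqP; rewrite eqn_leq ?a1 ?a2 h.
Qed.

Lemma exists_left_descent v : v <> 1 -> exists s, (len (val s * v) < len v)%N.
Proof.
have [[|s l] [sz e]] := len_reduced v; first by rewrite e big_nil.
move=> _; exists s; rewrite -sz e big_cons genKl; exact: len_le.
Qed.

(** Letters [t] and [s] are peeled off alternately while this shortens the element; what remains is
    the minimal representative of its coset under the dihedral subgroup of [s] and [t]. *)
Lemma strip_alt (s t : S) v : (len v < len (val s * v))%N ->
  exists k u, [/\ v = \prod_(r <- alt t s k) val r * u, len v = (k + len u)%N,
    (len u < len (val s * u))%N & (len u < len (val t * u))%N].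
Proof.
have [n] := ubnP (len v); elim: n s t v => // n IH s t v vn sv.
have [tv|tv] := len_gen_cases t v.
  by exists 0%N, v; rewrite big_nil mul1g tv; split.
have [||k [u [e el su tu]]] := IH t s (val t * v).
- by rewrite tv ltnS in vn.
- by rewrite genKl tv.
exists k.+1, u; split=> //; last by rewrite tv el.
by rewrite /= big_cons -mulgA -e genKl.
Qed.

Lemma alt_relation (s t : S) n : m s t = Some n ->
  \prod_(r <- alt t s n) val r = \prod_(r <- alt s t n) val r.
Proof.
move=> /coxeter_relation.
rewrite -word_eval_pairs word_eval_letters relator_letters mul2n -addnn.
rewrite alt_cat big_cat /= => /mulg1_eq.
by rewrite prod_rev rev_alt; case: (odd n) => ->.
Qed.

(** If $k\ge n$, the braid relation makes the word begin with [s], and left multiplication by [s]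
    would shorten it. *)
Lemma alt_reduced (s t : S) n k u :
  (len (\prod_(r <- alt t s k) val r * u) <
    len (val s * (\prod_(r <- alt t s k) val r * u)))%N ->
  len (\prod_(r <- alt t s k) val r * u) = (k + len u)%N ->
  m s t = Some n -> (0 < n)%N -> (k < n)%N.
Proof.
move=> lt el mst n0; rewrite ltnNge; apply/negP => nk; move: lt; apply/negP.
rewrite -leqNgt el -(subnKC nk) alt_cat big_cat /= (alt_relation mst).
case: n n0 nk mst => // n _ nk mst.
rewrite big_cons -!mulgA genKl.
rewrite mulgA -big_cat; apply: leq_trans (lenM _ _) _.
rewrite leq_add2r; apply: leq_trans (len_le _) _.
by rewrite size_cat size_alt; case: (odd _); rewrite size_alt addSn.
Qed.

Definition nonneg (phi : E -> R) : Prop :=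
  forall f, (forall x, (0 <= f x)%R) -> (0 <= phi f)%R.

Definition nonpos (phi : E -> R) : Prop :=
  forall f, (forall x, (0 <= f x)%R) -> (phi f <= 0)%R.

(* The value of an alternating word in s and t at a cone point is governed by
   Chebyshev values, which are nonnegative as long as the word is reduced. *)
Lemma act_nonneg v s f : (len v < len (val s * v))%N ->
  (forall x, (0 <= f x)%R) -> (0 <= act v f s)%R.
Proof.
move=> + f0; have [n] := ubnP (len v); elim: n s v => // n IH s v vn sv.
have [->|v1] := pselect (v = 1); first by rewrite act1.
have [t tv] := exists_left_descent v1.
have st : s <> t by move=> st; move: sv; rewrite ltnNge st (ltnW tv).
have [k [u [e el su tu]]] := strip_alt t sv.
(* If [k] were 0, then [v = u] would not have the descent [t]. Hence [u] is strictly shorter and the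
   induction applies to it. *)
have k0 : (0 < k)%N.
  case: k e el => // e _; move: tu; rewrite e big_nil mul1g in tv.
  by rewrite ltnNge (ltnW tv).
have un : (len u < n)%N.
  by rewrite ltnS el in vn; apply: leq_trans vn; rewrite -{1}(add0n (len u)) ltn_add2r.
have us := IH s u un su; have ut := IH t u un tu.
rewrite e actM act_prod alt_act.
have [c1 c2] : (0 <= cheb (- coef s t) k)%R /\ (0 <= cheb (- coef s t) k.+1)%R.
  rewrite /coef; case mst: (m s t) => [p|]; last first.
    by rewrite Ropp_involutive !cheb2; split; apply: pos_INR.
  have p1 := m_gt1 st mst.
  have kp : (k < p)%N.
    by apply: (@alt_reduced s t p k u) => //; rewrite -?e // ltnW.
  by rewrite Ropp_involutive; split; apply: cheb_cos_ge0 => //; apply: ltnW.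
by case: (odd k); nra.
Qed.

Lemma root_nonneg g s : (len g < len (g * val s))%N -> nonneg (root g s).
Proof.
move=> gs f f0; apply: act_nonneg => //.
by rewrite -(lenV g) -(lenV (g * val s)) invgM genV in gs.
Qed.

Lemma root_genR g s f : root (g * val s) s f = (- root g s f)%R.
Proof.
rewrite /root invgM genV actM act_gen /gen_act coef_ss.
by move: (act g^-1 f s) => x; ring.
Qed.

Lemma root_genL g s r f :
  root (val s * g) r f = (root g r f - f s * root g r (coef s))%R.
Proof.
rewrite /root invgM genV actM act_gen.
have -> : gen_act s f = (fun y => 1 * f y + (- f s) * coef s y)%R.
  by apply/funext => y; rewrite /gen_act; ring.
by rewrite act_linear; move: (act g^-1 f r) (act g^-1 (coef s) r) => x y; ring.
Qed.

Lemma root_sign g s : nonneg (root g s) \/ nonpos (root g s).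
Proof.
have := len_refl_neq g (reflection_gen s).
case: ltngtP => // h _; [right|left]; last exact: root_nonneg.
have : nonneg (root (g * val s) s) by apply: root_nonneg; rewrite genKr.
by move=> H f f0; have := H f f0; rewrite root_genR; lra.
Qed.

(** Every function is the difference of its positive and negative parts, so a root vanishing on the
    cone would vanish at its own coroot, where it is 2. *)
Lemma root_eq0 g s : ~ (forall f, (forall x, (0 <= f x)%R) -> root g s f = 0%R).
Proof.
move=> H; have := root_coroot g s; set f := coroot g s.
have -> : f = (fun y => 1 * Rmax (f y) 0 + (-1) * Rmax (- f y) 0)%R.
  by apply/funext => y; rewrite /Rmax; do !case: Rle_dec; lra.
by rewrite root_linear !H => [|x|x]; try (exact: Rmax_r); lra.
Qed.

Lemma root_not_both g s : nonneg (root g s) -> ~ nonpos (root g s).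
Proof.
by move=> p n; apply: (@root_eq0 g s) => f f0; apply: Rle_antisym; [apply: n|apply: p].
Qed.

(** A descent [s] of [w] makes [root w^-1 s] nonpositive, but a trivial action gives it the value 1
    on the constant function 1. *)
Lemma act_faithful w : (forall f, act w f = f) -> w = 1.
Proof.
move=> wf; apply: contrapT => w1; have [s sw] := exists_left_descent w1.
have : nonpos (root w^-1 s).
  move=> f f0; have : nonneg (root (w^-1 * val s) s).
    by apply: root_nonneg; rewrite genKr -(lenV w^-1) -(lenV (w^-1 * _)) invgM genV invgK.
  by move=> /(_ f f0); rewrite root_genR; lra.
move=> /(_ (fun=> 1%R)) => /(_ (fun=> Rle_0_1)).
by rewrite /root invgK wf; lra.
Qed.

Lemma act_inj g w : (forall f, act g f = act w f) -> g = w.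
Proof.
move=> gw; suff /mulg1_eq : g^-1 * w = 1 by rewrite invgK.
by apply: act_faithful => f; rewrite actM -gw actK.
Qed.

(** By symmetry of the pairing the coroots have the same ratio [c], and pairing root with coroot
    gives $2 = 2c^2$. Both reflections then act alike, and the action is faithful. *)
Lemma root_proportional (g h : W) (s r : S) (c : R) :
  (forall f, root g s f = c * root h r f)%R ->
  g * val s * g^-1 = h * val r * h^-1 /\ (c * c = 1)%R.
Proof.
move=> gh.
have co x : coroot g s x = (c * coroot h r x)%R.
  have co1 k q : coroot k q x = root 1 x (coroot k q) by rewrite /root invg1 act1.
  by rewrite !co1 ![root 1 x _]root_coroot_sym gh.
have cc : (c * c = 1)%R.
  have := root_coroot g s; have -> : coroot g s = (fun x => c * coroot h r x + 0 * coroot h r x)%R.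
    by apply/funext => x; rewrite co; ring.
  by rewrite root_linear gh root_coroot; lra.
split=> //; apply: act_inj => f; apply/funext => x; rewrite !act_reflection gh co.
by rewrite -[in RHS](Rmult_1_l (root h r f)) -cc; ring.
Qed.

Lemma root_reflection (g h : W) (s r : S) :
  g * val s * g^-1 = h * val r * h^-1 ->
  root g s = root h r \/ (forall f, root g s f = - root h r f)%R.
Proof.
move=> gh; pose c := (root g s (coroot h r) / 2)%R.
have prop f : root g s f = (c * root h r f)%R.
  (* Both sides are the displacement of [f] by the common reflection; the zero terms fit the shape
     of [root_linear]. *)
  have e : (fun x => root g s f * coroot g s x + 0 * coroot g s x)%R =
           (fun x => root h r f * coroot h r x + 0 * coroot g s x)%R.
    apply/funext => x; have := act_reflection g s f x.
    by rewrite gh act_reflection; lra.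
  have := congr1 (root g s) e; rewrite !root_linear root_coroot /c.
  by lra.
have [_ cc] := root_proportional prop.
have : ((c - 1) * (c + 1) = 0)%R by lra.
case/Rmult_integral => c1; [left; apply/funext => f|right=> f]; rewrite prop.
  have -> : c = 1%R by lra.
  by ring.
have -> : c = (-1)%R by lra.
by ring.
Qed.

(** On the face [f s = 0] of the cone [s] does not change the root, so both signs hold and it
    vanishes there. It then vanishes on the whole hyperplane and is a multiple of the simple root of
    [s]. *)
Lemma root_simple_neg g s r : nonneg (root g r) -> nonpos (root (val s * g) r) ->
  g * val r * g^-1 = val s.
Proof.
move=> p n.
have z0 f : (forall x, (0 <= f x)%R) -> f s = 0%R -> root g r f = 0%R.
  move=> f0 fs; have := p f f0; have := n f f0.
  by rewrite root_genL fs; lra.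
have z f : f s = 0%R -> root g r f = 0%R.
  move=> fs; have -> : f = (fun y => 1 * Rmax (f y) 0 + (-1) * Rmax (- f y) 0)%R.
    by apply/funext => y; rewrite /Rmax; do !case: Rle_dec; lra.
  rewrite root_linear !z0; first lra.
  - by move=> x; apply: Rmax_r.
  - by rewrite fs Ropp_0; apply: Rmax_left; lra.
  - by move=> x; apply: Rmax_r.
  - by rewrite fs; apply: Rmax_left; lra.
have [] := @root_proportional g 1 r s (root g r (coef s) / 2)%R.
  move=> f; have -> : root 1 s f = f s by rewrite /root invg1 act1.
  have := z (fun y => 1 * f y + (- f s / 2) * coef s y)%R.
  by rewrite coef_ss root_linear => /(_ ltac:(lra)); lra.
by gsimp.
Qed.

(** * Positive roots of reflections *)

Lemma exists_positive_root t : reflections S t ->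
  exists p : W * S, t = p.1 * val p.2 * p.1^-1 /\ nonneg (root p.1 p.2).
Proof.
move=> /reflectionP[g [s ->]]; have [p|n] := root_sign g s; first by exists (g, s).
exists (g * val s, s); split=> /=.
  by rewrite invgM genV !mulgA genKr.
by move=> f f0; rewrite root_genR; have := n f f0; lra.
Qed.

(* Junk value 0 outside the set of reflections. *)
Definition pos_root (t : W) : E -> R :=
  match pselect (reflections S t) with
  | left rt => let p := projT1 (cid (exists_positive_root rt)) in root p.1 p.2
  | right _ => fun=> 0%R
  end.

Definition pos_coroot (t : W) : E :=
  match pselect (reflections S t) with
  | left rt => let p := projT1 (cid (exists_positive_root rt)) in coroot p.1 p.2
  | right _ => fun=> 0%R
  end.

Lemma pos_rootP t : reflections S t -> exists g s,
  [/\ t = g * val s * g^-1, pos_root t = root g s, pos_coroot t = coroot g s &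
      nonneg (pos_root t)].
Proof.
rewrite /pos_root /pos_coroot; case: pselect => // rt _.
by case: cid => -[g s] /= [e p]; exists g, s.
Qed.

Lemma pos_root_coroot t : reflections S t -> pos_root t (pos_coroot t) = 2%R.
Proof. by move=> /pos_rootP[g [s [_ -> -> _]]]; apply: root_coroot. Qed.

Lemma pos_root_coroot_sym t r : reflections S t -> reflections S r ->
  pos_root t (pos_coroot r) = pos_root r (pos_coroot t).
Proof.
move=> /pos_rootP[g [s [_ -> -> _]]] /pos_rootP[h [q [_ -> -> _]]].
exact: root_coroot_sym.
Qed.

Lemma pos_root_inj t r (c : R) : reflections S t -> reflections S r ->
  (forall f, pos_root t f = c * pos_root r f)%R -> t = r.
Proof.
move=> /pos_rootP[g [s [-> -> _ _]]] /pos_rootP[h [q [-> -> _ _]]].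
by case/root_proportional.
Qed.

Lemma dual_act_reflection t r f : reflections S t -> reflections S r ->
  dual_act t (pos_root r) f =
  (pos_root r f - pos_root r (pos_coroot t) * pos_root t f)%R.
Proof.
move=> Rt Rr; rewrite /dual_act (reflectionV Rt).
move: Rt Rr => /pos_rootP[g [s [et -> -> _]]] /pos_rootP[h [q [_ -> _ _]]].
have -> : act t f = (fun x => 1 * f x + (- root g s f) * coroot g s x)%R.
  by apply/funext => x; rewrite et act_reflection; ring.
by rewrite root_linear; ring.
Qed.

Lemma dual_act_pos_root_sign w t : reflections S t ->
  dual_act w (pos_root t) = pos_root (w * t * w^-1) \/
  (forall f, dual_act w (pos_root t) f = - pos_root (w * t * w^-1) f)%R.
Proof.
move=> Rt; have [g [s [e -> _ _]]] := pos_rootP Rt.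
have [h [r [e' -> _ _]]] := pos_rootP (reflectionJ w Rt).
rewrite dual_act_root; apply: root_reflection.
by rewrite -e' e; gsimp.
Qed.

Lemma pos_root_not_nonpos t : reflections S t -> ~ nonpos (pos_root t).
Proof.
move=> /pos_rootP[g [s [_ -> _ p]]]; exact: root_not_both.
Qed.

(** Induction removing a left descent [r] of [w]. If restoring [r] changed the sign,
    [root_simple_neg] would give [w * t = val r * w], which is shorter than [w]. *)
Lemma dual_act_nonneg w t : reflections S t -> (len w < len (w * t))%N ->
  nonneg (dual_act w (pos_root t)).
Proof.
move=> Rt; have [g [s [e re _ p]]] := pos_rootP Rt; rewrite re dual_act_root.
have [n] := ubnP (len w); elim: n w => // n IH w wn wt.
have [w1|w1] := pselect (w = 1); first by rewrite w1 mul1g -re.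
have [r rw] := exists_left_descent w1.
have p' : nonneg (root (val r * w * g) s).
  apply: IH; first exact: leq_trans rw _.
  apply: leq_trans rw _; rewrite -ltnS; apply: leq_trans wt _.
  have [|] := len_gen_cases r (w * t); rewrite mulgA => ->; last exact: leqnn.
  exact/ltnW/ltnW.
have [//|n'] := root_sign (w * g) s.
have := @root_simple_neg (val r * w * g) r s p'.
rewrite -mulgA genKl mulgA => /(_ n') wr; move: wt; rewrite ltnNge => /negP[].
have -> : w * t = val r * w; last exact: ltnW.
have : val r * w * t * (val r * w)^-1 = val r by rewrite -[RHS]wr e; gsimp.
move/(congr1 (fun x => val r * x * (val r * w))).
by rewrite -!mulgA mulVg mulg1 !genKl.
Qed.

Lemma dual_act_pos_root w t : reflections S t ->
  dual_act w (pos_root t) = if (len (w * t) < len w)%N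
    then (fun f => - pos_root (w * t * w^-1) f)%R else pos_root (w * t * w^-1).
Proof.
move=> Rt; have Rwt := reflectionJ w Rt.
case: ifP => wt; last first.
  have [//|e] := dual_act_pos_root_sign w Rt.
  have /dual_act_nonneg : (len w < len (w * t))%N.
    by move: (len_refl_neq w Rt) wt; case: ltngtP.
  move=> /(_ Rt) p; case: (pos_root_not_nonpos Rwt) => f f0.
  by have := p f f0; rewrite e; lra.
have [e|] := dual_act_pos_root_sign w Rt; last by move=> e; apply/funext.
(* The decreasing case reduces to the increasing one for [w * t], because [t] negates its own
   root. *)
have wtt : w * t * t = w by rewrite -mulgA (reflection_sqr Rt) mulg1.
have /dual_act_nonneg : (len (w * t) < len (w * t * t))%N by rewrite wtt.
move=> /(_ Rt) p; case: (pos_root_not_nonpos Rwt) => f f0.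
have := p f f0; rewrite dual_actM -e.
have -> : dual_act t (pos_root t) = (fun f => - pos_root t f)%R.
  by apply/funext => h; rewrite dual_act_reflection // pos_root_coroot //; ring.
by rewrite /dual_act; lra.
Qed.

(** * Inversions and involutions *)

Definition inversions (w : W) : set W :=
  [set t | reflections S t /\ (len (w * t) < len w)%N].

Lemma inversionsP w t : reflections S t ->
  inversions w t <-> nonpos (dual_act w (pos_root t)).
Proof.
move=> Rt; have Rwt := reflectionJ w Rt; rewrite dual_act_pos_root //; split.
  move=> [_ ->] f f0; have [g [s [_ _ _ p]]] := pos_rootP Rwt.
  by have := p f f0; lra.
by case: ifP => // _ n; case: (pos_root_not_nonpos Rwt).
Qed.

Lemma dual_act_inversion w t : inversions w t ->
  dual_act w (pos_root t) = (fun f => - pos_root (w * t * w^-1) f)%R.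
Proof. by move=> [Rt wt]; rewrite dual_act_pos_root // wt. Qed.

Lemma dual_act_not_inversion w t : reflections S t -> ~ inversions w t ->
  dual_act w (pos_root t) = pos_root (w * t * w^-1).
Proof.
by move=> Rt nwt; rewrite dual_act_pos_root //; case: ifP => // wt; case: nwt.
Qed.

Lemma inversions_gen s t : inversions (val s) t -> t = val s.
Proof.
move=> st; have Rt := st.1; move/(inversionsP _ Rt): st.
have [g [r [-> -> _ p]]] := pos_rootP Rt.
by rewrite dual_act_root; apply: root_simple_neg.
Qed.

Lemma gen_inversion s w : inversions w (val s) <-> (len (w * val s) < len w)%N.
Proof. by split=> [[]|] // ws; split=> //; apply: reflection_gen. Qed.

Lemma inversions1 t : ~ inversions 1 t.
Proof. by move=> [_]; rewrite len1. Qed.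

Lemma inversionsM g w t : reflections S t -> inversions (g * w) t ->
  inversions w t \/ inversions g (w * t * w^-1).
Proof.
move=> Rt gwt; have [|nwt] := pselect (inversions w t); first by left.
right; apply/inversionsP; first exact: reflectionJ.
by rewrite -dual_act_not_inversion // -dual_actM; apply/inversionsP.
Qed.

Lemma inversionsM_inv g w t : inversions w t ->
  ~ inversions g (w * t * w^-1) -> inversions (g * w) t.
Proof.
move=> wt ng; have Rt := wt.1; apply/inversionsP => //.
have Rwt := reflectionJ w Rt; have := dual_act_not_inversion Rwt ng.
rewrite dual_actM (dual_act_inversion wt) => e f f0.
have [h [s [_ _ _ p]]] := pos_rootP (reflectionJ g Rwt).
have := p f f0; rewrite -e /dual_act; lra.
Qed.

Lemma finite_inversions w : finite_set (inversions w).
Proof.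
have [l ->] := exists_letters w; elim: l => [|s l IH].
  rewrite big_nil; apply: (@sub_finite_set _ _ set0) => // t.
  by move/inversions1.
rewrite big_cons; set p := \prod_(_ <- _) _.
apply: (@sub_finite_set _ _ (inversions p `|` [set p^-1 * val s * p])).
  move=> t st; have [|/inversions_gen e] := inversionsM st.1 st; [by left|right].
  by rewrite /= -e; gsimp.
by rewrite finite_setU; split=> //; apply: finite_set1.
Qed.

Lemma exists_inversion w : w <> 1 -> exists s, inversions w (val s).
Proof.
move=> w1; have [|s sw] := @exists_left_descent w^-1.
  by move/(congr1 (fun x => x^-1)); rewrite invgK invg1.
exists s; apply/gen_inversion; move: sw.
by rewrite lenV -(lenV (val s * _)) invgM invgK genV.
Qed.

Lemma dual_act_fix_commute w t : reflections S t ->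
  dual_act w (pos_root t) = pos_root t -> w * t * w^-1 = t.
Proof.
move=> Rt wt; have Rwt := reflectionJ w Rt.
have [e|e] := dual_act_pos_root_sign w Rt.
  by apply: (@pos_root_inj _ _ 1) => // f; rewrite -wt e; ring.
apply: (@pos_root_inj _ _ (-1)) => // f; rewrite -wt e; ring.
Qed.

(** The set $E(w)$: an inversion root goes to a negative root, and commuting with [w] makes that the
    opposite of the root itself. *)
Definition negated (w : W) : set W :=
  [set t | inversions w t /\ commute w t].

Lemma negatedP w t : reflections S t ->
  negated w t <-> (forall f, dual_act w (pos_root t) f = - pos_root t f)%R.
Proof.
move=> Rt; split=> [[wt cwt] f|H].
  by rewrite (dual_act_inversion wt) cwt; gsimp.
have iwt : inversions w t.
  apply/inversionsP => // f f0; rewrite H.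
  by have [g [s [_ _ _ p]]] := pos_rootP Rt; have := p f f0; lra.
split=> //; have : w * t * w^-1 = t.
  apply: (@pos_root_inj _ _ 1) => //; first exact: reflectionJ.
  by move=> f; have := H f; rewrite (dual_act_inversion iwt); lra.
by move/(congr1 (fun x => x * w)); rewrite mulgVK.
Qed.

Lemma negatedJ g w t : negated w t -> negated (g * w * g^-1) (g * t * g^-1).
Proof.
move=> wt; have Rt := wt.1.1; have Rgt := reflectionJ g Rt.
apply/negatedP => // f; have /negatedP - /(_ Rt) H := wt.
have [e|e] := dual_act_pos_root_sign g Rt.
  by rewrite -e -dual_actM mulgVK dual_actM {1}/dual_act H.
have -> : pos_root (g * t * g^-1) = (fun f => - dual_act g (pos_root t) f)%R.
  by apply/funext => f'; rewrite e; ring.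
rewrite {1}/dual_act -/(dual_act (g * w * g^-1) (dual_act g (pos_root t)) f).
by rewrite -dual_actM mulgVK dual_actM {1}/dual_act H /dual_act; ring.
Qed.

Lemma finite_negated w : finite_set (negated w).
Proof. by apply: sub_finite_set (finite_inversions w) => t []. Qed.

(** Since [w] commutes with [b], the reflected root of [a] is fixed by [w]. Its component along the
    root of [b] is also negated, hence zero. *)
Lemma fixed_negated_orthogonal w a b : reflections S a ->
  dual_act w (pos_root a) = pos_root a -> negated w b ->
  dual_act b (pos_root a) = pos_root a.
Proof.
move=> Ra wa wb; have Rb := wb.1.1; have /negatedP - /(_ Rb) H := wb.
have c0 : pos_root a (pos_coroot b) = 0%R.
  have := congr1 (fun phi => phi (pos_coroot b))
            (erefl (dual_act (w * b) (pos_root a))).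
  rewrite {2}(wb.2) !dual_actM wa.
  rewrite {1}/dual_act !dual_act_reflection //.
  have := congr1 (fun phi => phi (pos_coroot b)) wa; rewrite {1}/dual_act => ->.
  have := H (pos_coroot b); rewrite {1}/dual_act => ->.
  by rewrite pos_root_coroot //; lra.
by apply/funext => f; rewrite dual_act_reflection // c0; ring.
Qed.

Lemma fixed_negated_commute w a b : reflections S a ->
  dual_act w (pos_root a) = pos_root a -> negated w b -> commute a b /\ a <> b.
Proof.
move=> Ra wa wb; have ba := fixed_negated_orthogonal Ra wa wb; split.
  have := dual_act_fix_commute Ra ba.
  by move/(congr1 (fun x => x * b)); rewrite mulgVK => /esym.
move=> ab; have Rb := wb.1.1; have := congr1 (fun phi => phi (pos_coroot a)) ba.
by rewrite dual_act_reflection // ab pos_root_coroot //; lra.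
Qed.

(** The elements [val s * w] and [w * val s] are mutually inverse, so both are shorter than [w]. The
    root of [s] stays inverted by [val s * w], since [val s] inverts no root but its own. *)
Lemma len_conj_lt s w : w * w = 1 -> inversions w (val s) ->
  ~ commute w (val s) -> (len (val s * w * val s) < len w)%N.
Proof.
move=> w2 ws cws; have wV : w^-1 = w by apply: mulg1_eq.
have sw : inversions (val s * w) (val s).
  apply: inversionsM_inv => //; move/inversions_gen => e; apply: cws.
  by rewrite /commute -{2}e; gsimp.
apply: leq_trans sw.2 _; rewrite -lenV invgM wV genV; exact: ltnW ws.2.
Qed.

(* Either s is a descent of w commuting with w, and then w s is shorter and
   negates fewer roots, or conjugation by s shortens w. *)
Lemma involution_generated_negated w : w * w = 1 -> generated (negated w) w.
Proof.
have [n] := ubnP (len w); elim: n w => // n IH w wn w2.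
have [->|w1] := pselect (w = 1); first exact: generated1.
have [s ws] := exists_inversion w1.
have [c|c] := pselect (commute w (val s)); last first.
  have sw := len_conj_lt w2 ws c.
  have := IH (val s * w * val s) (leq_trans sw wn).
  have -> : val s * w * val s * (val s * w * val s) = 1.
    by rewrite !mulgA genKr -(mulgA _ w w) w2 mulg1 gen_sqr.
  move=> /(_ erefl) /(@generated_sub_conj _ _ (negated w) (val s)).
  have -> : val s * (val s * w * val s) * (val s)^-1 = w.
    by rewrite genV !mulgA genKr gen_sqr mul1g.
  apply=> t /(@negatedJ (val s)); rewrite genV -!mulgA genKl.
  by rewrite gen_sqr mulg1 => ?; apply: sub_generated.
have nws : negated w (val s) by [].
(* Both factors negate the root of [s], and the two signs cancel. *)
have w's : dual_act (w * val s) (pos_root (val s)) = pos_root (val s).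
  have H f := (negatedP w (reflection_gen s)).1 nws f.
  apply/funext => f; rewrite dual_actM {1}/dual_act dual_act_reflection //;
    try exact: reflection_gen.
  rewrite pos_root_coroot; last exact: reflection_gen.
  by have := H f; rewrite /dual_act => ->; ring.
have : generated (negated (w * val s)) (w * val s).
  apply: IH; first exact: leq_trans ws.2 wn.
  by rewrite mulgA -(mulgA w) -c mulgA w2 mul1g gen_sqr.
move=> w'; rewrite -{2}(genKr s w); apply: generatedM; last exact: sub_generated.
move: w'; apply: generated_sub => t wt; apply: sub_generated.
have Rt := wt.1.1; apply/negatedP => // f.
have [_ tc] := fixed_negated_commute (reflection_gen s) w's wt.
have ts := fixed_negated_orthogonal (reflection_gen s) w's wt.
(* By orthogonality [s] fixes the root of [t], so [w] negates it just as [w * val s] does. *)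
have o : pos_root t (pos_coroot (val s)) = 0%R.
  rewrite pos_root_coroot_sym //; last exact: reflection_gen.
  have := congr1 (fun phi => phi (pos_coroot t)) ts.
  rewrite dual_act_reflection //; last exact: reflection_gen.
  by rewrite pos_root_coroot //; lra.
have /negatedP - /(_ Rt) H := wt.
rewrite -(genKr s w) dual_actM -H; congr (dual_act _ _ _).
apply/funext => h; rewrite dual_act_reflection ?o //; last exact: reflection_gen.
by ring.
Qed.

(** * Reflection subgroups *)

Definition gen_conj s (H : set W) : set W := [set x | H (val s * x * val s)].

Lemma gen_conj_closed s (H : set W) :
  group_closed [in H] -> group_closed [in gen_conj s H].
Proof.
move=> Hc; have HB := Hc.2.
split=> [|x y]; rewrite !inE /gen_conj /=.
  by rewrite mulg1 gen_sqr; have := Hc.1; rewrite inE.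
move=> xH yH; have := HB _ _ (mem_set xH) (mem_set yH); rewrite inE.
by rewrite !invgM !genV !mulgA genKr.
Qed.

Lemma canonical_generatorsP (H : set W) u : canonical_generators S H u <->
  [/\ reflections S u, H u & forall r, H r -> inversions u r -> r = u].
Proof.
split=> [[[Ru Hu] nex]|[Ru Hu inj]].
  split=> // r Hr [Rr ur]; apply: contrapT => ru; apply: nex.
  by exists r.
split=> // -[r [[Rr Hr] ru ur]]; apply: ru; exact: inj.
Qed.

(** An inversion [r] in [H] of the conjugate is traced through its three factors. Inversion at
    either outer factor would put [val s] into [H], so it occurs at [u] and there it must be [u]
    itself. *)
Lemma canonical_generators_gen_conj s (H : set W) u : group_closed [in H] ->
  ~ H (val s) -> canonical_generators S (gen_conj s H) u ->
  canonical_generators S H (val s * u * val s).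
Proof.
move=> Hc nHs /canonical_generatorsP[Ru Hu inj]; apply/canonical_generatorsP; split=> //.
  by have := reflectionJ (val s) Ru; rewrite genV.
move=> r Hr rI; have Rr := rI.1.
have srs : val s * (val s * r * val s) * val s = r by rewrite !mulgA genKr gen_sqr mul1g.
suff : val s * r * val s = u by move=> <-; rewrite srs.
apply: inj; first by rewrite /gen_conj /= srs.
move: rI => /inversionsM - /(_ Rr) [/inversions_gen rs|]; first by case: nHs; rewrite -rs.
rewrite genV => /inversionsM[|//|/inversions_gen e].
  by have := reflectionJ (val s) Rr; rewrite genV.
case: nHs; have Hsus : H (val s * u * val s) by [].
suff <- : (val s * u * val s) * r * (val s * u * val s)^-1 = val s.
  by apply: (closedM Hc); [apply: (closedM Hc)|apply: (closedV Hc)].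
have -> : val s * u * val s * r * (val s * u * val s)^-1 =
          val s * (u * (val s * r * val s) * u^-1) * val s.
  by rewrite !invgM !genV !mulgA.
by rewrite e genKr.
Qed.

(* Dyer's argument: conjugating the reflection subgroup by a simple reflection
   outside it carries canonical generators to canonical generators. *)
Lemma reflection_conj_canonical (H : set W) t : group_closed [in H] ->
  reflections S t -> H t -> exists g u,
  [/\ generated (canonical_generators S H) g, canonical_generators S H u &
      t = g * u * g^-1].
Proof.
have [n] := ubnP (len t); elim: n H t => // n IH H t tn Hc Rt Ht.
have canon s : H (val s) -> canonical_generators S H (val s).
  move=> Hs; apply/canonical_generatorsP; split=> //; first exact: reflection_gen.
  by move=> r _ /inversions_gen.
have t2 := reflection_sqr Rt.
have [s ts] := exists_inversion (reflection_neq1 Rt).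
have [tes|tns] := pselect (t = val s).
  exists 1, t; split; [exact: generated1 | rewrite tes; apply: canon; rewrite -tes // | by gsimp].
(* Otherwise [t] would negate the root of [s], making the two roots proportional and the reflections
   equal. *)
have ncts : ~ commute t (val s).
  move=> c; have ns : negated t (val s) by [].
  have H2 := (negatedP t (reflection_gen s)).1 ns; apply/tns/esym.
  apply: (@pos_root_inj _ _ (pos_root (val s) (pos_coroot t) / 2)%R) => //.
    exact: reflection_gen.
  move=> f; have := H2 f; rewrite dual_act_reflection //; last exact: reflection_gen.
  by lra.
have st := len_conj_lt t2 ts ncts.
have Rst : reflections S (val s * t * val s).
  by have := reflectionJ (val s) Rt; rewrite genV.
have sts : t = val s * (val s * t * val s) * val s by rewrite !mulgA genKr gen_sqr mul1g.
(* If [val s] is in [H], it is a canonical generator and the conjugation stays inside [H]. If not,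
   the induction is applied to the conjugate subgroup [gen_conj s H]. *)
have [Hs|nHs] := pselect (H (val s)).
  have [|g [u [gT uT e]]] := IH H _ (leq_trans st tn) Hc Rst.
    by apply: (closedM Hc) => //; apply: (closedM Hc).
  exists (val s * g), u; split=> //.
    by apply: generatedM => //; apply: sub_generated; apply: canon.
  by rewrite sts e invgM genV !mulgA.
have Hst : gen_conj s H (val s * t * val s) by rewrite /gen_conj /= -sts.
have [g [u [gT uT e]]] := IH _ _ (leq_trans st tn) (gen_conj_closed s Hc) Rst Hst.
exists (val s * g * val s), (val s * u * val s); split.
- have := @generated_sub_conj _ _ (canonical_generators S H) (val s) _ g gT.
  rewrite genV; apply=> x xT; apply: sub_generated.
  exact: canonical_generators_gen_conj.
- exact: canonical_generators_gen_conj.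
- by rewrite {1}sts e !invgM !genV !mulgA !genKr.
Qed.

(** Exchange condition for the reflection subgroup: [t] is inverted by the tail, or its conjugate by
    the tail is inverted by the first factor [u]. That conjugate lies in [H], so it equals [u] and
    cancels it. *)
Lemma canonical_generators_exchange (H : set W) (l : seq W) t :
  group_closed [in H] -> (forall x, x \in l -> canonical_generators S H x) ->
  H t -> inversions (\prod_(x <- l) x) t ->
  exists l' : seq W, [/\ forall x, x \in l' -> canonical_generators S H x,
    (size l' < size l)%N & \prod_(x <- l) x * t = \prod_(x <- l') x].
Proof.
move=> Hc + Ht; elim: l => [|u l IH] lT; first by rewrite big_nil => /inversions1.
rewrite big_cons => ut; have Rt := ut.1.
have lT' x : x \in l -> canonical_generators S H x.
  by move=> xl; apply: lT; rewrite inE xl orbT.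
have uT : canonical_generators S H u by apply: lT; rewrite inE eqxx.
have [lt|] := inversionsM Rt ut.
  have [l' [l'T sz e]] := IH lT' lt; exists (u :: l'); split=> [x||].
  - by rewrite inE => /orP[/eqP ->|/l'T].
  - by [].
  - by rewrite big_cons -e mulgA.
move/canonical_generatorsP: uT => [Ru Hu inj].
set p := \prod_(_ <- _) _; have Hp : H p.
  rewrite /p; elim: (l) lT' => [|y k IHk] kT.
    by rewrite big_nil; have := Hc.1; rewrite inE.
  rewrite big_cons; apply: (closedM Hc).
    by have /canonical_generatorsP[] := kT y (mem_head _ _).
  by apply: IHk => x xk; apply: kT; rewrite inE xk orbT.
move=> /inj e; exists l; split=> //; rewrite -/p -mulgA.
rewrite -[p * t](mulgVK p) e; last by do !apply: (closedM Hc) => //; apply: (closedV Hc).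
by rewrite mulgA (reflection_sqr Ru) mul1g.
Qed.

(** If the last letter is not an inversion of the product, it is one of the prefix, and the exchange
    yields a shorter word for the same element. *)
Lemma canonical_no_inversion (H : set W) k : group_closed [in H] ->
  generated (canonical_generators S H) k ->
  (forall u, canonical_generators S H u -> ~ inversions k u) -> k = 1.
Proof.
move=> Hc kT; have [|l [lT ->]] := generated_involutionsP _ kT.
  by move=> x /canonical_generatorsP[Rx _ _]; apply: reflection_sqr.
have [n] := ubnP (size l); elim: n l lT => // n IH l lT ln nk.
have [->|l0] := pselect (l = [::]); first by rewrite big_nil.
case/lastP: l l0 lT ln nk => // l u _ lT ln nk.
have uT : canonical_generators S H u by apply: lT; rewrite mem_rcons inE eqxx.
have := nk _ uT; move/canonical_generatorsP: uT => [Ru Hu _].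
have lT' x : x \in l -> canonical_generators S H x.
  by move=> xl; apply: lT; rewrite mem_rcons inE xl orbT.
move: nk; rewrite -cats1 big_cat big_seq1 /=; set p := \prod_(_ <- _) _ => nk nu.
have pu : inversions p u.
  split=> //; have : (len (p * u * u) < len (p * u))%N -> False by move=> ?; apply: nu.
  rewrite -mulgA (reflection_sqr Ru) mulg1.
  by have := len_refl_neq p Ru; case: ltngtP => // _ _ /(_ erefl).
have [l' [l'T sz e]] := canonical_generators_exchange Hc lT' Hu pu.
rewrite size_rcons ltnS in ln.
rewrite /p e; apply: IH => //; first exact: leq_trans sz (ltnW _).
by rewrite -e.
Qed.

(** * Finite components *)

(** The only alternative is that [a] negates the root of [b], which makes the two roots
    proportional. *)
Lemma commuting_reflections_fix a b : reflections S a -> reflections S b ->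
  a <> b -> commute a b -> dual_act a (pos_root b) = pos_root b.
Proof.
move=> Ra Rb ab c; have e : a * b * a^-1 = b by rewrite c; gsimp.
have := dual_act_pos_root_sign a Rb; rewrite e => -[//|H].
case: ab; apply/esym; apply: (@pos_root_inj _ _ (pos_root b (pos_coroot a) / 2)%R) => // f.
by have := H f; rewrite dual_act_reflection //; lra.
Qed.

Lemma order_at_least3P a b : reflections S a -> reflections S b ->
  order_at_least 3 (a * b) <-> ~ commute a b.
Proof.
move=> Ra Rb; have a2 := reflection_sqr Ra; have b2 := reflection_sqr Rb; split.
  move=> H c; apply: (H 2) => //.
  by rewrite expg2 {1}c mulgA -(mulgA b) a2 mulg1.
move=> c [|[|[|n]]] // _; rewrite ?expg1 ?expg2 => e; apply: c.
  by have := mulg1_eq e; rewrite (reflectionV Ra) => ->.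
by have := mulg1_eq e; rewrite invgM (reflectionV Ra) (reflectionV Rb).
Qed.

(** * Reflections with a finite conjugacy class in a reflection subgroup *)

Section FiniteClasses.
Variable H : set W.
Hypothesis Hc : group_closed [in H].

Local Notation T := (canonical_generators S H).
Local Notation component u := (generated (graph_component T u)).

Lemma canonical_reflection u : T u -> reflections S u.
Proof. by case/canonical_generatorsP. Qed.

Lemma generated_canonical_sub k : generated T k -> H k.
Proof.
move: k; apply: generated_ind.
- exact: closed1 Hc.
- by move=> g h; apply: closedM Hc.
- by move=> g; apply: closedV Hc.
- by move=> u /canonical_generatorsP[].
Qed.

Lemma component_sub u k : component u k -> generated T k.
Proof.
by move: k; apply: generated_sub => v [Tv _]; apply: sub_generated.
Qed.

Lemma component_edge u v w : graph_component T u v -> T w ->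
  ~ commute v w -> graph_component T u w.
Proof.
move=> [Tv uv] Tw c; split=> //; apply: rt_trans uv _; apply: rt_step.
by split=> //; apply/order_at_least3P => //; apply: canonical_reflection.
Qed.

(** A canonical generator either commutes with a given generator of the component or is joined to it
    and so lies in the component. *)
Lemma component_normal u g x : generated T g -> component u x ->
  component u (g * x * g^-1).
Proof.
move=> gT; have [|l [lT ->]] := generated_involutionsP _ gT.
  by move=> y /canonical_reflection/reflection_sqr.
elim: l lT => [|r l IH] lT xu; first by rewrite big_nil; gsimp.
have Tr : T r by apply: lT; rewrite inE eqxx.
rewrite big_cons; set p := \prod_(_ <- _) _.
have -> : r * p * x * (r * p)^-1 = r * (p * x * p^-1) * r^-1 by gsimp.
move: {IH xu} (p * x * p^-1) (IH (fun y yl => lT y (@mem_behead _ (r :: l) y yl)) xu).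
apply: generated_sub_conj => y yu.
have [c|c] := pselect (commute y r).
  by rewrite -c mulgK; apply: sub_generated.
by apply: generatedJ; apply: sub_generated => //; apply: component_edge c.
Qed.

Section Fixator.
Variables (u z : W).
Hypothesis zu : component u z.
Hypothesis zfix : forall g, H g ->
  dual_act z (pos_root (g * u * g^-1)) = pos_root (g * u * g^-1).

(* If b moves the root of a, then the root of b is a combination of the roots
   of a and of b a b, so a linear map fixing these also fixes the root of b. *)
Lemma fixed_root_spread v v' : coxeter_edge T v v' ->
  (forall g, H g -> dual_act z (pos_root (g * v * g^-1)) = pos_root (g * v * g^-1)) ->
  forall g, H g -> dual_act z (pos_root (g * v' * g^-1)) = pos_root (g * v' * g^-1).
Proof.
move=> [Tv Tv' ed] fixv g Hg.
have Rv := canonical_reflection Tv; have Rv' := canonical_reflection Tv'.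
have Ra := reflectionJ g Rv; have Rb := reflectionJ g Rv'.
set a := g * v * g^-1 in Ra *; set b := g * v' * g^-1 in Rb *.
have nc : ~ commute a b.
  move=> c; have /order_at_least3P := ed; apply=> //.
  have : g^-1 * (a * b) * g = g^-1 * (b * a) * g by rewrite c.
  by rewrite /a /b; gsimp.
have fa : dual_act z (pos_root a) = pos_root a by apply: fixv.
have fba : dual_act z (dual_act b (pos_root a)) = dual_act b (pos_root a).
  have e : b * a * b^-1 = (g * v') * v * (g * v')^-1.
    by rewrite /a /b; gsimp.
  have Hgv : H (g * v').
    by apply: closedM Hc Hg _; case/canonical_generatorsP: Tv'.
  have fe : dual_act z (pos_root (b * a * b^-1)) = pos_root (b * a * b^-1).
    by rewrite e; apply: fixv.
  have [->//|es] := dual_act_pos_root_sign b Ra.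
  have -> : dual_act b (pos_root a) = (fun f => - pos_root (b * a * b^-1) f)%R.
    exact/funext.
  by apply/funext => f; rewrite -{2}fe.
have c0 : pos_root a (pos_coroot b) <> 0%R.
  move=> c0; apply: nc; have : dual_act b (pos_root a) = pos_root a.
    by apply/funext => f; rewrite dual_act_reflection // c0; ring.
  move/(dual_act_fix_commute Ra)/(congr1 (fun x => x * b)).
  by rewrite mulgVK => /esym.
apply/funext => f; have := congr1 (fun phi => phi f) fba.
have := congr1 (fun phi => phi f) fa; rewrite /dual_act -/(dual_act b _ _).
rewrite -/(dual_act b (pos_root a) (act z^-1 f)) => fa1.
rewrite -/(dual_act b (pos_root a) f) !dual_act_reflection // fa1 => fb.
apply: (Rmult_eq_reg_l (pos_root a (pos_coroot b))) => //.
lra.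
Qed.

(** Fixed roots spread along edges to all generators of the component. Other canonical generators
    commute with the component, so their roots are fixed too, and [z] inverts no canonical
    generator. *)
Lemma fixator_trivial : z = 1.
Proof.
have spread v v' : clos_refl_trans W (coxeter_edge T) v v' ->
  (forall g, H g -> dual_act z (pos_root (g * v * g^-1)) = pos_root (g * v * g^-1)) ->
  forall g, H g -> dual_act z (pos_root (g * v' * g^-1)) = pos_root (g * v' * g^-1).
  elim=> {v v'} [v v' ed|//|v v' v'' _ IH _ IH' /IH /IH' //].
  exact: fixed_root_spread.
apply: (canonical_no_inversion Hc (component_sub zu)) => v Tv zv.
have Rv := canonical_reflection Tv.
suff fv : dual_act z (pos_root v) = pos_root v.
  by move/inversionsP: zv => /(_ Rv); rewrite fv; apply: pos_root_not_nonpos.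
have [uv|nuv] := pselect (graph_component T u v).
  by have := spread _ _ uv.2 zfix 1 (closed1 Hc); gsimp.
suff fk k : component u k -> dual_act k (pos_root v) = pos_root v by apply: fk.
move: k; apply: generated_ind.
- exact: dual_act1.
- by move=> g h gv hv; rewrite dual_actM hv.
- by move=> g gv; rewrite -{1}gv -dual_actM mulVg dual_act1.
- move=> j uj; have Tj := uj.1; apply: commuting_reflections_fix => //.
  + exact: canonical_reflection.
  + by move=> jv; apply: nuv; rewrite -jv.
  + by apply: contrapT => c; apply: nuv; apply: component_edge c.
Qed.

End Fixator.

Lemma finite_class_component u : T u -> finite_set [set g * u * g^-1 | g in H] ->
  finite_set (component u).
Proof.
move=> Tu finC; have Ru := canonical_reflection Tu.
(* An element of the component is recorded by the signed permutation it induces on the roots of the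
   finite class; [fixator_trivial] shows that this determines it. *)
apply: (@finite_separated _ (W * bool)%type _ _ [set g * u * g^-1 | g in H]
  ([set g * u * g^-1 | g in H] `*` [set: bool])
  (fun k c => (k * c * k^-1, `[< inversions k c >]))) => //.
- by apply: finite_setX => //; apply: finite_finset.
- move=> k _ ku [g Hg <-]; split=> //=; exists (k * g); last by gsimp.
  by apply: (closedM Hc) => //; apply: generated_canonical_sub; apply: component_sub ku.
- move=> k k' ku k'u e; suff : k'^-1 * k = 1 by move/mulg1_eq; rewrite invgK.
  apply: (@fixator_trivial u) => //.
    by apply: generatedM => //; apply: generatedV.
  move=> g Hg; set c := g * u * g^-1; have Rc : reflections S c by apply: reflectionJ.
  have [e1 e2] : (k * c * k^-1, `[< inversions k c >]) =
                 (k' * c * k'^-1, `[< inversions k' c >]) by apply: e; exists g.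
  rewrite dual_actM; have -> : dual_act k (pos_root c) = dual_act k' (pos_root c).
    have [kc|kc] := pselect (inversions k c).
      have k'c : inversions k' c by apply/asboolP; rewrite -e2; apply/asboolP.
      by rewrite !dual_act_inversion // e1.
    have k'c : ~ inversions k' c by move=> /asboolP; rewrite -e2 => /asboolP.
    by rewrite !dual_act_not_inversion // e1.
  by rewrite -dual_actM mulVg dual_act1.
Qed.

Lemma finite_class_finite_part t : reflections S t -> H t ->
  finite_set [set g * t * g^-1 | g in H] -> finite_part T t.
Proof.
move=> Rt Ht finC.
have [g [u [gT uT e]]] := reflection_conj_canonical Hc Rt Ht.
have Hg := generated_canonical_sub gT.
have finK : finite_set (component u).
  apply: finite_class_component => //; apply: sub_finite_set finC => _ [h Hh <-].
  exists (h * g^-1); first by apply: (closedM Hc) => //; apply: (closedV Hc).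
  by rewrite e; gsimp.
apply: sub_generated; exists (component u); first by split=> //; exists u.
rewrite e; apply: component_normal => //; apply: sub_generated.
by split=> //; apply: rt_refl.
Qed.

End FiniteClasses.

(** * Reflections under isomorphisms *)

(** Each reflection negated by [y] commutes with [val s] and differs from it. Its class under the
    perpendicular subgroup stays in [D], because that subgroup centralises [val s]. *)
Lemma involution_fixing_perp_fin s (D : set W) y :
  y * y = 1 -> dual_act y (pos_root (val s)) = pos_root (val s) ->
  finite_set D -> negated y `<=` D ->
  (forall g t, commute g (val s) -> D t -> D (g * t * g^-1)) ->
  reflection_perp_fin S (val s) y.
Proof.
move=> y2 ys finD yD DJ; have := involution_generated_negated y2.
apply: generated_sub => t yt; have Rt := yt.1.1.
have [st nst] := fixed_negated_commute (reflection_gen s) ys yt.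
apply: (@finite_class_finite_part (reflection_perp S (val s))) => //.
- exact: generated_closed.
- by apply: sub_generated; split=> // /esym.
- apply: sub_finite_set finD => _ [g Rg <-]; apply: DJ; last exact: yD.
  apply/commute_sym; move: g Rg; apply: generated_centralize => r [_ _ rs].
  exact/commute_sym.
Qed.

Lemma finite_involutions_perp_fin s (X : set W) : finite_set X ->
  (forall x, X x -> x * x = 1 /\ commute x (val s)) ->
  (forall g x, commute g (val s) -> X x -> X (g * x * g^-1)) ->
  forall x, X x -> reflection_perp_fin S (val s) x \/
                   reflection_perp_fin S (val s) (x * val s).
Proof.
move=> finX Xs XJ x Xx; have [x2 xs] := Xs x Xx; have Rs := reflection_gen s.
pose D := \bigcup_(z in X) (negated z `|` negated (z * val s)).
have finD : finite_set D.
  by apply: bigcup_finite => // z _; rewrite finite_setU; split; apply: finite_negated.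
have DJ g t : commute g (val s) -> D t -> D (g * t * g^-1).
  move=> gs [z Xz zt]; exists (g * z * g^-1); first exact: XJ.
  case: zt => /(negatedJ g) zt; [by left | right].
  have -> // : g * z * g^-1 * val s = g * (z * val s) * g^-1.
  by rewrite !mulgA -!(mulgA (g * z)) (commuteV (commute_sym gs)).
have xsV : x * val s * x^-1 = val s by rewrite xs mulgK.
(* As [x] commutes with [val s], it fixes or negates the root of [s]; in the second case [x * val s]
   fixes it. *)
have [nx|nx] := pselect (inversions x (val s)); [right|left].
  apply: (@involution_fixing_perp_fin _ D) => //.
  - by rewrite mulgA -(mulgA x) -xs mulgA x2 mul1g gen_sqr.
  - have H := dual_act_inversion nx; rewrite xsV in H.
    have Hs : dual_act (val s) (pos_root (val s)) = (fun f => - pos_root (val s) f)%R.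
      by apply/funext => f; rewrite dual_act_reflection // pos_root_coroot //; ring.
    rewrite dual_actM Hs; apply/funext => f.
    have := congr1 (fun phi => phi f) H; rewrite /dual_act => ->; ring.
  - by move=> t xt; exists x => //; right.
apply: (@involution_fixing_perp_fin _ D) => //.
- by rewrite dual_act_not_inversion // xsV.
- by move=> t xt; exists x => //; left.
Qed.

(* With w = (ab)^k and n = 2k+1 one has a w a = w^-1 and w w a b = 1. *)
Lemma odd_relation_conj (a b : W) n : a * a = 1 -> b * b = 1 ->
  (a * b) ^+ n = 1 -> odd n -> exists w, b = w * a * w^-1.
Proof.
move=> a2 b2 abn on; exists ((a * b) ^+ n./2); move: abn.
rewrite -{1}(odd_double_half n) on add1n -addnn -addnS expgnDr expgS.
set w := (a * b) ^+ _ => e.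
have aV : a^-1 = a by apply: mulg1_eq.
have bV : b^-1 = b by apply: mulg1_eq.
have wV : w^-1 = a * w * a^-1.
  have -> : a * w * a^-1 = w ^ a^-1 by rewrite /conjg invgK mulgA.
  by rewrite conjXg /conjg invgK mulgA aV mulgA a2 mul1g -expVgn invgM aV bV.
have : w * w * a * b = 1.
  have c : commute w (a * b) by apply/commute_sym/commuteX.
  by rewrite -e -c !mulgA.
move/mulg1_eq/(congr1 (fun x => x^-1)); rewrite invgK bV => <-.
by rewrite wV aV !mulgA -(mulgA w a) a2 mulg1.
Qed.

(* The number of letters conjugate to s is well defined modulo 2 on W; it would
   vanish on A if A missed the class of s. *)
Lemma reflections_generating (A : set W) : A `<=` reflections S ->
  (forall g a, A a -> A (g * a * g^-1)) -> (forall w, generated A w) ->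
  A = reflections S.
Proof.
move=> AS AJ Agen; apply/seteqP; split=> // _ /reflectionP[g [s ->]]; apply: (AJ g).
pose Q (r : S) := `[< conjugate_in (val s) (val r) >].
(* An odd relation makes its two generators conjugate, so membership in the class of [s] has a
   parity on the group. *)
have Qm (r q : S) n : m r q = Some n -> odd n -> Q r = Q q.
  move=> mrq on; have [w e] := odd_relation_conj (gen_sqr r) (gen_sqr q) (coxeter_relation mrq) on.
  apply/asboolP/asboolP => -[h eh].
    by exists (w * h); rewrite e eh; gsimp.
  exists (w^-1 * h); have -> : val r = w^-1 * val q * w by rewrite e; gsimp.
  by rewrite eh; gsimp.
apply: contrapT => nAs.
have Q0 w : parity Q w = false.
  move: w (Agen w); apply: generated_ind.
  - exact: parity1.
  - by move=> x y; rewrite (parityM Qm) => -> ->.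
  - by move=> x; rewrite (parityV Qm).
  - move=> a Aa; have /reflectionP[h [r e]] := AS _ Aa.
    rewrite e (parityJ Qm) (parity_gen Qm); apply/asboolP => -[w er]; apply: nAs.
    have -> : val s = (h * w)^-1 * a * ((h * w)^-1)^-1 by rewrite e er; gsimp.
    exact: AJ.
have := Q0 (val s); rewrite (parity_gen Qm) => /asboolP; apply.
by exists 1; gsimp.
Qed.

End CoxeterWords.

(** * Images of reflections under a group isomorphism *)

Lemma generated_subsingleton (G : groupType) (A : set G) :
  (forall x y, A x -> A y -> x = y) -> (forall x, A x -> x * x = 1) ->
  forall g, generated A g -> g = 1 \/ A g.
Proof.
move=> A1 A2; apply: generated_ind => [|g h|g|g]; [by left| | |by right].
  move=> [->|Ag] [->|Ah]; rewrite ?mul1g ?mulg1; [by left|by right|by right|].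
  by left; rewrite (A1 _ _ Ag Ah) A2.
move=> [->|Ag]; first by left; rewrite invg1.
by right; rewrite (mulg1_eq (A2 _ Ag)).
Qed.

Lemma multiplicative1 (G K : groupType) (f : {multiplicative G -> K}) : f 1 = 1.
Proof. by apply: (mulgI (f 1)); rewrite -gmulfM !mulg1. Qed.

Lemma multiplicativeV (G K : groupType) (f : {multiplicative G -> K}) x :
  f x^-1 = (f x)^-1.
Proof. by apply/esym/mulg1_eq; rewrite -gmulfM mulgV multiplicative1. Qed.

Lemma iso_simple_reflection (W : groupType) (S : set W) (s : W)
    (W' : groupType) (S' : set W') (f : {multiplicative W -> W'}) :
  coxeter_system S -> S s -> perp_fin_trivial_or_conj S s ->
  coxeter_system S' -> bijective f -> reflections S' (f s).
Proof.
move=> [m [cm pres]] Ss fin [m' [cm' pres']] [f' fK f'K].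
have finj : injective f := can_inj fK.
pose s0 : S := SigSub (mem_set Ss); have es : s = val s0 by [].
have Rs : reflections S s by rewrite es; apply: reflection_gen.
have s2 : s * s = 1 := reflection_sqr cm pres Rs.
have fs2 : f s * f s = 1 by rewrite -gmulfM s2 multiplicative1.
pose X := f @^-1` negated S' (f s).
have finX : finite_set X.
  apply: (@sub_finite_set _ _ (f' @` negated S' (f s))).
    by move=> x Xx; exists (f x).
  by apply: finite_image; apply: finite_negated cm' pres' _.
have X2 x : X x -> x * x = 1 /\ commute x s.
  move=> [[Rx _] c]; split; apply: finj; rewrite !gmulfM //.
  by rewrite multiplicative1 (reflection_sqr cm' pres' Rx).
have XJ g x : commute g s -> X x -> X (g * x * g^-1).
  move=> gs Xx; rewrite /X /= !gmulfM multiplicativeV.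
  have -> : f s = f g * f s * (f g)^-1.
    by rewrite (gmulf_commute f gs) mulgK.
  exact: (negatedJ cm' pres').
have Xfin := finite_involutions_perp_fin cm pres (s := s0) finX X2 XJ.
apply: contrapT => nR.
have X1 x : X x -> x <> 1.
  move=> [[Rx _] _] x1; have := reflection_neq1 cm' pres' Rx.
  by rewrite x1 multiplicative1.
have Xns x : X x -> x * s <> 1.
  move=> Xx xs; apply: nR; have : x = s by rewrite -[x](mulgK s) xs mul1g (mulg1_eq s2).
  by move=> <-; exact: Xx.1.1.
(* If the finite part is trivial, [X] is empty. Otherwise it is [{1, t}]: the case [x = t] would
   make [f s] conjugate to the reflection [f x], so [x * s = t] and [x] is determined. *)
have Xeq x y : X x -> X y -> x = y.
  case: fin => [e|[t [Rt [w et] e]]] Xx Xy.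
    have := Xfin x Xx; rewrite -/(val s0) -es e => -[/X1|/Xns]; by case.
  have t2 : t * t = 1 := reflection_sqr cm pres Rt.
  have Xt z : X z -> z * s = t.
    move=> Xz; have gt g : generated [set t] g -> g = 1 \/ g = t.
      by apply: generated_subsingleton => [a b -> ->|a ->].
    have := Xfin z Xz; rewrite -es e => -[/gt[/X1//|zt]|/gt[/Xns//|//]].
    case: nR; have [[Rz _] _] := Xz; have := reflectionJ (f w)^-1 Rz.
    by rewrite zt et !gmulfM multiplicativeV; gsimp.
  by rewrite -[x](mulgK s) -[y](mulgK s) !Xt.
have nsub := involution_generated_negated cm' pres' fs2.
(* With at most one negated reflection, [f s] is 1 or that reflection; injectivity excludes the
   first and [nR] the second. *)
have [a b na nb|a [[Ra _] _]|fs1|[[]//]] := generated_subsingleton _ _ nsub.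
- by rewrite -(f'K a) -(f'K b); congr (f _); apply: Xeq; rewrite /X /= f'K.
- exact: (reflection_sqr cm' pres' Ra).
- apply: (reflection_neq1 cm pres Rs); apply: finj.
  by rewrite fs1 multiplicative1.
Qed.

Lemma iso_reflections (W : groupType) (S : set W)
    (W' : groupType) (S' : set W') (f : {multiplicative W -> W'}) :
  coxeter_system S -> coxeter_system S' -> bijective f ->
  f @` S `<=` reflections S' -> f @` reflections S = reflections S'.
Proof.
move=> [m [cm pres]] [m' [cm' pres']] [f' fK f'K] fS.
apply: (reflections_generating cm' pres').
- move=> _ [_ [g [s [Ss ->]]] <-]; rewrite !gmulfM multiplicativeV.
  by apply: reflectionJ; apply: fS; exists s.
- move=> g _ [t Rt <-]; exists (f' g * t * (f' g)^-1); first exact: reflectionJ.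
  by rewrite !gmulfM multiplicativeV f'K.
- move=> w; rewrite -(f'K w); have [l ->] := exists_letters cm pres (f' w).
  elim: l => [|s l IH]; first by rewrite big_nil multiplicative1; apply: generated1.
  rewrite big_cons gmulfM; apply: generatedM => //; apply: sub_generated.
  by exists (val s) => //; apply: reflection_gen.
Qed.

Theorem theorem3p7 (W : groupType) (S : set W) (cox : coxeter_system S) :
  (forall s : W, S s -> perp_fin_trivial_or_conj S s ->
     forall (W' : groupType) (S' : set W') (f : {multiplicative W -> W'}),
       coxeter_system S' -> bijective f -> reflections S' (f s))
  /\
  ((forall s : W, S s -> perp_fin_trivial_or_conj S s) ->
     (forall (W' : groupType) (S' : set W') (f : {multiplicative W -> W'}),
        coxeter_system S' -> bijective f ->
        f @` S `<=` reflections S' /\ f @` reflections S = reflections S')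
     /\
     (forall S2 : set W, coxeter_system S2 -> reflections S2 = reflections S)).
Proof.
split=> [s Ss fin W' S' f cox' fbij|fin].
  exact: iso_simple_reflection cox Ss fin cox' fbij.
have refl (W' : groupType) (S' : set W') (f : {multiplicative W -> W'}) :
    coxeter_system S' -> bijective f ->
    f @` S `<=` reflections S' /\ f @` reflections S = reflections S'.
  move=> cox' fbij; have fS : f @` S `<=` reflections S'.
    by move=> _ [s Ss <-]; apply: iso_simple_reflection cox Ss (fin s Ss) cox' fbij.
  by split=> //; apply: iso_reflections cox cox' fbij fS.
split=> // S2 cox2.
(* Both systems live on the same group, so the identity serves as the isomorphism. *)
have [_ <-] := refl W S2 idfun cox2 (inv_bij (fun x => erefl)).
exact: image_id.
Qed.
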